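(* Fix $d\in\mathbb{N}$ and $\varepsilon>0$. Then there are only finitely many graphs (up to isomorphism) with maximum degree at most $d$ which do not have an $\varepsilon$-almost-internal bisection. There are also only finitely many such graphs which do not have an $\varepsilon$-almost-external bisection. In both cases, the desired bisections can be found via a randomised algorithm whose expected runtime is linear in the number of vertices.
   Context: All graphs are finite and simple. A bisection of a graph is a red-blue colouring of its vertices in which the numbers of red and blue vertices are equal (or differ by one, if the total number of vertices is odd). A red-blue colouring of an $n$-vertex graph is an $\varepsilon$-almost-internal partition if all but (at most) $\varepsilon n$ vertices have at least half of their neighbours in the same colour as themselves; it is an $\varepsilon$-almost-external partition if all but (at most) $\varepsilon n$ vertices have at least half of their neighbours in the opposite colour. An $\varepsilon$-almost-internal (respectively, $\varepsilon$-almost-external) bisection is a bisection which is an $\varepsilon$-almost-internal (respectively, $\varepsilon$-almost-external) partition. *)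

(* Defs.v *)
From HB Require Import structures.
From mathcomp Require Import all_boot all_order all_algebra.
From mathcomp Require Import all_classical all_reals ereal.

Set Implicit Arguments.
Unset Strict Implicit.
Unset Printing Implicit Defensive.

Import Order.TTheory GRing.Theory Num.Theory.

Local Open Scope nat_scope.

(** * Finite simple graphs *)

Record sgraph := SGraph {
  vertex :> finType;
  adj : rel vertex;
  adj_sym : symmetric adj;
  adj_irrefl : irreflexive adj }.

Definition nbrs (G : sgraph) (x : G) : {set G} := [set y | adj x y].

Definition max_degree (G : sgraph) : nat := \max_(x : G) #|nbrs x|.

Definition graph_iso (G H : sgraph) : Prop :=
  exists2 f : G -> H, bijective f & forall x y, adj (f x) (f y) = adj x y.

Definition finitely_many_up_to_iso (P : sgraph -> Prop) : Prop :=
  exists (N : nat) (H : 'I_N -> sgraph),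
    forall G, P G -> exists i, graph_iso G (H i).

(** * Partitions; a colouring is a boolean function, [true] being red *)

Definition bisection (G : sgraph) (c : G -> bool) : Prop :=
  let red := #|[set x | c x]| in
  let blue := #|[set x | ~~ c x]| in
  red = blue \/ odd #|G| /\ (red = blue.+1 \/ blue = red.+1).

Definition internal_at (G : sgraph) (c : G -> bool) (x : G) : bool :=
  #|nbrs x| <= 2 * #|[set y in nbrs x | c y == c x]|.

Definition external_at (G : sgraph) (c : G -> bool) (x : G) : bool :=
  #|nbrs x| <= 2 * #|[set y in nbrs x | c y != c x]|.

Definition almost_internal (R : realType) (eps : R) (G : sgraph)
    (c : G -> bool) : Prop :=
  (#|[set x | ~~ internal_at c x]|%:R <= eps * #|G|%:R)%R.

Definition almost_external (R : realType) (eps : R) (G : sgraph)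
    (c : G -> bool) : Prop :=
  (#|[set x | ~~ external_at c x]|%:R <= eps * #|G|%:R)%R.

Definition almost_internal_bisection (R : realType) (eps : R) (G : sgraph)
    (c : G -> bool) : Prop :=
  bisection c /\ almost_internal eps c.

Definition almost_external_bisection (R : realType) (eps : R) (G : sgraph)
    (c : G -> bool) : Prop :=
  bisection c /\ almost_external eps c.

(** * Randomised algorithms

  Structured programs for a random access machine with registers and
  finitely many arrays (those the program mentions), both numbered by [nat],
  whose only source of randomness is a fair coin.  Every elementary step costs
  one time unit.  The only arithmetic is increment and decrement, so a value
  never exceeds the largest input value or program constant plus the elapsed
  time; hence unit cost does not hide computations on long integers. *)

Inductive test :=
| TestLt of nat & nat
| TestEq of nat & nat.

Inductive cmd :=
| Skip
| Const of nat & nat          (* Const x k    : r_x := k *)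
| Copy of nat & nat           (* Copy x y     : r_x := r_y *)
| Inc of nat                  (* Inc x        : r_x := r_x + 1 *)
| Dec of nat                  (* Dec x        : r_x := r_x - 1, truncated at 0 *)
| Get of nat & nat & nat      (* Get x a y    : r_x := a[r_y] *)
| Put of nat & nat & nat      (* Put a x y    : a[r_x] := r_y *)
| Flip of nat                 (* Flip x       : r_x := a fair coin, 0 or 1 *)
| Seq of cmd & cmd
| If of test & cmd & cmd
| While of test & cmd.

Record memory := Memory {
  reg : nat -> nat;
  arr : nat -> nat -> nat }.

Definition upd (A : Type) (f : nat -> A) (i : nat) (v : A) : nat -> A :=
  fun j => if j == i then v else f j.

Definition set_reg (m : memory) (x v : nat) : memory :=
  Memory (upd (reg m) x v) (arr m).

Definition set_arr (m : memory) (a i v : nat) : memory :=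
  Memory (reg m) (upd (arr m) a (upd (arr m a) i v)).

Definition eval_test (m : memory) (t : test) : bool :=
  match t with
  | TestLt x y => reg m x < reg m y
  | TestEq x y => reg m x == reg m y
  end.

(* The stack of commands still to be executed, and the memory. *)
Definition config := (seq cmd * memory)%type.

Definition halted (s : config) : bool := nilp s.1.

(* [b] is the coin available at this step; only [Flip] looks at it. *)
Definition step (b : bool) (s : config) : config :=
  let: (k, m) := s in
  if k isn't c :: k' then s else
  match c with
  | Skip => (k', m)
  | Const x v => (k', set_reg m x v)
  | Copy x y => (k', set_reg m x (reg m y))
  | Inc x => (k', set_reg m x (reg m x).+1)
  | Dec x => (k', set_reg m x (reg m x).-1)
  | Get x a y => (k', set_reg m x (arr m a (reg m y)))
  | Put a x y => (k', set_arr m a (reg m x) (reg m y))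
  | Flip x => (k', set_reg m x b)
  | Seq c1 c2 => (c1 :: c2 :: k', m)
  | If t c1 c2 => ((if eval_test m t then c1 else c2) :: k', m)
  | While t c1 => (if eval_test m t then c1 :: k else k', m)
  end.

Fixpoint run (w : seq bool) (s : config) : config :=
  if w is b :: w' then run w' (step b s) else s.

(* The number of steps executed before halting, truncated at [size w]. *)
Fixpoint runtime (w : seq bool) (s : config) : nat :=
  if w is b :: w' then
    if halted s then 0 else (runtime w' (step b s)).+1
  else 0.

(* E[min(T, t)], where T is the (possibly infinite) running time: min(T, t)
   depends only on the first t coins. *)
Definition truncated_expected_runtime (R : realType) (s : config) (t : nat) : R :=
  ((\sum_(w : t.-tuple bool) (runtime w s)%:R) / 2%:R ^+ t)%R.

(* E[T] is the supremum (monotone limit) of the E[min(T, t)]. *)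
Definition expected_runtime (R : realType) (s : config) : \bar R :=
  ereal_sup (range (fun t => (truncated_expected_runtime R s t)%:E)).

(** * Graphs as inputs, colourings as outputs *)

(* An adjacency-list presentation of G: an arbitrary ordering [vs] of the
   vertices, and for every vertex an arbitrary ordering of its neighbours. *)
Definition presentation (G : sgraph) (vs : seq G) (nb : G -> seq G) : Prop :=
  perm_eq vs (enum G) /\ forall x, perm_eq (nb x) (enum (nbrs x)).

(* Vertices are named by their index in [vs].  Register 0 holds the number n of
   vertices; array 1 is the concatenation of the adjacency lists; array 0 holds
   the offsets: the list of vertex i occupies the cells j of array 1 with
   arr 0 i <= j < arr 0 (i + 1).  All the rest is 0. *)
Definition input_memory (G : sgraph) (vs : seq G) (nb : G -> seq G) : memory :=
  let lists := [seq [seq index y vs | y <- nb x] | x <- vs] in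
  Memory
    (fun x => if x is 0 then size vs else 0)
    (fun a i => match a with
       | 0 => if i <= size vs then sumn (take i (shape lists)) else 0
       | 1 => nth 0 (flatten lists) i
       | _ => 0
       end).

(* The colour of vertex i is read off array 2: nonzero means red. *)
Definition output_colouring (G : sgraph) (vs : seq G) (m : memory) : G -> bool :=
  fun x => arr m 2 (index x vs) != 0.

(* A (Las Vegas) randomised algorithm which, for every graph in [dom] having a
   colouring that satisfies [good], never outputs anything but such a
   colouring, and has expected runtime O(n).  A finite expected runtime implies
   that it halts almost surely. *)
Definition linear_time_findable (R : realType) (dom : sgraph -> Prop)
    (good : forall G : sgraph, (G -> bool) -> Prop) : Prop :=
  exists (p : cmd) (C : nat), forall G : sgraph,
    dom G -> (exists c : G -> bool, good G c) ->
    forall (vs : seq G) (nb : G -> seq G), presentation vs nb ->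
      let s := ([:: p], input_memory vs nb) in
      (forall w : seq bool, halted (run w s) ->
         good G (output_colouring vs (run w s).2)) /\
      (expected_runtime R s <= (C * #|G|.+1)%:R%:E)%E.

(* Main.v *)
Require Import Defs.
From mathcomp Require Import all_classical all_reals ereal.
From mathcomp Require Import all_boot all_order all_algebra.
From mathcomp Require Import zify ring lra.

Set Implicit Arguments.
Unset Strict Implicit.
Unset Printing Implicit Defensive.

Import Order.TTheory GRing.Theory Num.Theory.

Local Open Scope nat_scope.

(** Majority dynamics, run for a bounded number of rounds from a random
    colouring, does what is wanted.

    Label the vertices properly with [d.+1] labels, greedily. In one round, treat
    the labels in turn: every unhappy vertex of the current label changes colour.
    These vertices are pairwise non-adjacent, so each change increases the number
    of agreeing pairs of neighbours ([potential_update]), which never exceeds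
    [n * d]. Hence all rounds together make at most [n * d] changes
    ([sum_round_moves]). A vertex that is unhappy after a round has a neighbour
    which has changed during that round ([bad_sweep]), so a round with few
    changes ends in a colouring with few unhappy vertices. Averaging over the
    initial colouring, the seed, gives one round [j], bounded in terms of [d] and
    [eps] only, which makes few changes on average ([calm_round]).

    The colouring after [j] rounds is also nearly balanced. The dynamics commutes
    with the exchange of the two colours, and the final colour of a vertex depends
    only on the seed within a bounded distance. Flipping the seed around [u]
    therefore flips the final colour of [u] and leaves alone that of any far away
    [v]: the two colours are uncorrelated ([spins_uncorrelated]). So the difference
    of the two colour counts has second moment [O(n)]
    ([imbalance_second_moment]), and is typically of order [sqrt n]. By the
    inequalities of Markov and Chebyshev at least half of the seeds lead, for
    large [n], to a colouring with few unhappy vertices which becomes a bisection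
    after [o(n)] changes; each of them affects at most [d.+1] vertices
    ([half_of_seeds_rebalance_well]). This bounds the order of the exceptional
    graphs.

    The algorithm draws a seed with the coins and, after every round, balances a
    copy of the current colouring and counts its unhappy vertices; it starts again
    when no round within the bound succeeds. An attempt takes linear time, and the
    probability of success is at least one half for large [n]. On the finitely
    many remaining orders it is bounded below by a constant, because the good
    colouring whose existence is assumed may itself be the seed
    ([seeds_suffice_threshold]). The expected number of attempts is thus bounded
    ([las_vegas]), and the expected time is linear ([good_findable]).

    The boolean [e] selects the internal ([false]) or the external ([true])
    version; only the meaning of agreement with a neighbour depends on it. *)

(** * Majority dynamics along a proper labelling *)

Section Dynamics.

Variables (G : sgraph) (e : bool).
Implicit Types (c s : G -> bool) (x y : G).

Definition agree c x y : bool := e (+) (c y == c x).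

Definition unhappy c x : bool :=
  ~~ (#|nbrs x| <= 2 * #|[set y in nbrs x | agree c x y]|).

Definition bad c : nat := #|[set x | unhappy c x]|.

Definition red c : nat := #|[set x | c x]|.

Definition imbalance c : nat := `|red c - red (fun x => ~~ c x)|.

Definition differ c c' : {set G} := [set x | c x != c' x].

Definition proper (lab : G -> nat) : Prop :=
  forall x y, adj x y -> lab x != lab y.

Variable lab : G -> nat.

Definition movers (l : nat) c : {set G} :=
  [set x | (lab x == l) && unhappy c x].

Definition update (l : nat) c : G -> bool :=
  fun x => if x \in movers l c then ~~ c x else c x.

Definition sweep (ls : seq nat) c : G -> bool :=
  foldl (fun c' l => update l c') c ls.

Fixpoint moves (ls : seq nat) c : nat :=
  if ls is l :: ls' then #|movers l c| + moves ls' (update l c) else 0.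

Lemma agree_sym c x y : agree c x y = agree c y x.
Proof. by rewrite /agree eq_sym. Qed.

Lemma eq_unhappy c c' x :
  c x = c' x -> (forall y, adj x y -> c y = c' y) ->
  unhappy c x = unhappy c' x.
Proof.
move=> ex ey; congr (~~ (_ <= 2 * _)); apply: eq_card => y.
rewrite !inE; case: (boolP (adj x y)) => //= /ey eqy.
by rewrite /agree ex eqy.
Qed.

(** Flipping a vertex exchanges its agreeing and its disagreeing neighbours. *)
Lemma unhappy_flip c c' x :
  c x = ~~ c' x -> (forall y, adj x y -> c y = c' y) ->
  unhappy c' x -> ~~ unhappy c x.
Proof.
move=> ex ey; rewrite /unhappy negbK -ltnNge.
have -> : [set y in nbrs x | agree c x y] =
          nbrs x :\: [set y in nbrs x | agree c' x y].
  apply/setP => y; rewrite !inE; case: (boolP (adj x y)) => //= /ey eqy.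
  rewrite /agree ex eqy !andbT; case: e (c' x) (c' y) => [] [] [] //=.
rewrite cardsD (_ : _ :&: _ = [set y in nbrs x | agree c' x y]); first by lia.
by apply/setP => y; rewrite !inE; case: (adj x y).
Qed.

Definition potential c : nat :=
  \sum_x #|[set y in nbrs x | agree c x y]|.

Lemma card_nbrs_sum (P : rel G) x :
  #|[set y in nbrs x | P x y]| = \sum_y (adj x y && P x y).
Proof.
rewrite -sum1_card big_mkcond; apply: eq_bigr => y _.
by rewrite !inE; case: (_ && _).
Qed.

Lemma potential_le c d : max_degree G <= d -> potential c <= #|G| * d.
Proof.
move=> Gd; rewrite -sum_nat_const; apply: leq_sum => x _.
apply: leq_trans Gd; apply: leq_trans (leq_bigmax x) => /=.
by apply: subset_leq_card; apply/subsetP => y; rewrite !inE => /andP[].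
Qed.

Hypothesis lab_proper : proper lab.

(** Movers form an independent set, so each of them gains at least one agreeing
    neighbour and nobody interferes; by symmetry of agreement the neighbours
    gain as much again. *)
Lemma potential_update l c :
  potential c + #|movers l c| <= potential (update l c).
Proof.
pose a c' x y : int := (adj x y && agree c' x y)%:R%R.
pose m x : int := (x \in movers l c)%:R%R.
pose k x y : int := ((adj x y)%:R - 2 * a c x y)%R.
have potE c' : ((potential c')%:R = \sum_x \sum_y a c' x y :> int)%R.
  rewrite /potential natr_sum; apply: eq_bigr => x _.
  by rewrite card_nbrs_sum natr_sum.
have kC x y : k x y = k y x by rewrite /k /a adj_sym agree_sym.
have aE x y : (a (update l c) x y = a c x y + (m x * k x y + m y * k y x))%R.
  rewrite [k y x]kC /k /a; case: (boolP (adj x y)) => [xy|_] /=; last by ring.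
  have: ~~ ((x \in movers l c) && (y \in movers l c)).
    rewrite !inE; apply/negP => /andP[/andP[/eqP lx _] /andP[/eqP ly _]].
    by have := lab_proper xy; rewrite lx ly eqxx.
  rewrite /m /agree /update; case: (x \in _); case: (y \in _) => //= _;
    by case: e (c x) (c y) => [] [] [].
have kE x : (m x <= m x * (\sum_y k x y))%R.
  rewrite /m; case: (boolP (x \in _)) => [|_]; last by rewrite mul0r.
  rewrite inE mul1r => /andP[_]; rewrite /unhappy -ltnNge /k sumrB -mulr_sumr.
  have -> : (\sum_y (adj x y)%:R = #|nbrs x|%:R :> int)%R.
    rewrite (_ : nbrs x = [set y in nbrs x | xpredT y]); last first.
      by apply/setP => y; rewrite !inE andbT.
    rewrite (card_nbrs_sum (fun _ _ => true)) natr_sum.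
    by apply: eq_bigr => y _; rewrite andbT.
  have -> : (\sum_y a c x y = #|[set y in nbrs x | agree c x y]|%:R)%R.
    by rewrite (card_nbrs_sum (agree c)) natr_sum.
  by lia.
have mE : (#|movers l c|%:R = \sum_x m x :> int)%R.
  by rewrite -sum1_card natr_sum big_mkcond; apply: eq_bigr => x _;
    rewrite /m; case: (x \in _).
have: (#|movers l c|%:R <= \sum_x (m x * \sum_y k x y) :> int)%R.
  by rewrite mE; apply: ler_sum => x _; apply: kE.
have: ((potential (update l c))%:R = (potential c)%:R +
        (\sum_x m x * (\sum_y k x y)) *+ 2 :> int)%R.
  rewrite !potE mulr2n.
  rewrite [X in (_ + (_ + X))%R](_ : _ = \sum_x \sum_y m y * k y x)%R; last first.
    by rewrite exchange_big; apply: eq_bigr => x _; rewrite mulr_sumr.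
  rewrite -!big_split; apply: eq_bigr => x _ /=.
  by rewrite mulr_sumr -!big_split; apply: eq_bigr => y _; rewrite aE.
by lia.
Qed.

Lemma potential_sweep ls c : potential c + moves ls c <= potential (sweep ls c).
Proof.
elim: ls c => [|l ls IH] c /=; first by rewrite addn0.
by rewrite addnA; apply: leq_trans (IH _); rewrite leq_add2r potential_update.
Qed.

Lemma card_nbrsS d (S : {set G}) (P : pred G) :
  max_degree G <= d ->
  (forall x, P x -> exists2 y, y \in S & adj x y) ->
  #|[set x | P x]| <= d * #|S|.
Proof.
move=> Gd PS; rewrite mulnC.
apply: (@leq_trans #|\bigcup_(y in S) nbrs y|).
  apply: subset_leq_card; apply/subsetP => x; rewrite inE => /PS[y yS xy].
  by apply/bigcupP; exists y; rewrite // inE adj_sym.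
rewrite -sum_nat_const; elim/big_rec2: _ => [|y n A yS IH].
  by rewrite cards0.
apply: leq_trans (leq_card_setU _ _) _; apply: leq_add => //.
exact: leq_trans (leq_bigmax y) Gd.
Qed.

(** A vertex is happy right after its own label has been treated; it can only
    become unhappy again through a later move of a neighbour. *)
Lemma bad_sweep_labels d ls treated c :
  max_degree G <= d ->
  #|[set x | (lab x \in treated ++ ls) && unhappy (sweep ls c) x]| <=
    #|[set x | (lab x \in treated) && unhappy c x]| + d * moves ls c.
Proof.
move=> Gd; elim: ls treated c => [|l ls IH] treated c /=.
  by rewrite cats0 muln0 addn0.
rewrite -cat_rcons; apply: leq_trans (IH _ _) _.
rewrite mulnDr addnA leq_add2r.
pose T := [set x | [exists y, (y \in movers l c) && adj x y]].
have T_le : #|T| <= d * #|movers l c|.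
  by apply: card_nbrsS => // x /existsP[y /andP[? ?]]; exists y.
apply: leq_trans (leq_add (leqnn _) T_le).
apply: leq_trans (leq_card_setU _ _); apply: subset_leq_card.
apply/subsetP => x; rewrite !inE mem_rcons inE => /andP[lx ux].
case: (boolP [exists y, _]) => [_|noT]; first by rewrite orbT.
rewrite orbF.
have same y : adj x y -> update l c y = c y.
  rewrite /update => xy; case: ifP => // ym.
  by case/existsP: noT; exists y; rewrite ym.
case: (boolP (x \in movers l c)) => [xm|xm].
  have flipped : update l c x = ~~ c x by rewrite /update xm.
  move: xm; rewrite inE => /andP[_ xu].
  by have := unhappy_flip flipped same xu; rewrite ux.
have kept : update l c x = c x by rewrite /update (negbTE xm).
move: ux; rewrite (eq_unhappy kept same) => ux; rewrite ux andbT.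
case/predU1P: lx => // lx.
by move: xm; rewrite inE lx eqxx ux.
Qed.

(** Each vertex that ends up unhappy is next to a change, and the changed vertex has
    at most [d] neighbours. *)
Lemma bad_sweep d ls c :
  max_degree G <= d -> (forall x, lab x \in ls) ->
  bad (sweep ls c) <= d * moves ls c.
Proof.
move=> Gd labs.
apply: leq_trans (leq_trans (bad_sweep_labels ls [::] c Gd) _).
  by apply: subset_leq_card; apply/subsetP => x; rewrite !inE labs.
rewrite (eq_card (B := pred0)) ?card0 ?add0n // => x.
by rewrite !inE.
Qed.

(** Recolouring a vertex affects nobody but itself and its neighbours. *)
Lemma bad_differ d c c' :
  max_degree G <= d -> bad c' <= bad c + d.+1 * #|differ c c'|.
Proof.
move=> Gd; set S := differ c c'.
pose T := [set x | [exists y, (y \in S) && adj x y]].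
have T_le : #|T| <= d * #|S|.
  by apply: card_nbrsS => // x /existsP[y /andP[? ?]]; exists y.
rewrite mulSn; apply: leq_trans (leq_add (leqnn _) (leq_add (leqnn _) T_le)).
apply: (@leq_trans #|[set x | unhappy c x] :|: (S :|: T)|); last first.
  apply: leq_trans (leq_card_setU _ _) _; rewrite leq_add2l.
  exact: leq_card_setU.
apply: subset_leq_card; apply/subsetP => x; rewrite inE => ux.
rewrite in_setU.
case: (boolP (x \in S :|: T)) => [_|]; rewrite ?orbT // orbF.
rewrite !inE negb_or negbK => /andP[/eqP xE /existsP noT].
rewrite (@eq_unhappy _ c') // => y xy.
apply/eqP; apply/negPn; apply/negP => yS.
by apply: noT; exists y; rewrite inE yS.
Qed.

(** ** Symmetry and locality *)

Lemma unhappyN c x : unhappy (fun y => ~~ c y) x = unhappy c x.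
Proof.
congr (~~ (_ <= 2 * _)); apply: eq_card => y.
by rewrite !inE /agree; case: (c x) (c y) => [] [].
Qed.

Lemma eq_sweep ls c c' : c =1 c' -> sweep ls c =1 sweep ls c'.
Proof.
elim: ls c c' => [|l ls IH] c c' eqc //=; apply: IH => x.
by rewrite /update !inE (@eq_unhappy c c') ?eqc.
Qed.

Lemma sweepN ls c : sweep ls (fun x => ~~ c x) =1 (fun x => ~~ sweep ls c x).
Proof.
elim: ls c => [|l ls IH] c //= x; rewrite -(IH (update l c)).
by apply: eq_sweep => y; rewrite /update !inE unhappyN; case: ifP.
Qed.

Lemma sweep_cat ls ls' c : sweep (ls ++ ls') c = sweep ls' (sweep ls c).
Proof. exact: foldl_cat. Qed.

Fixpoint ball (k : nat) (u : G) : {set G} :=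
  if k is k'.+1 then \bigcup_(w in ball k' u) (w |: nbrs w) else [set u].

(** Information travels a single edge per label, which makes the ball of radius
    [size ls] a zone of influence. *)
Lemma sweep_local ls c c' u :
  {in ball (size ls) u, c =1 c'} -> sweep ls c u = sweep ls c' u.
Proof.
elim: ls c c' => [|l ls IH] c c' eqc /=; first by apply: eqc; rewrite inE.
apply: IH => w wB; rewrite /update !inE.
have eqw y : y \in w |: nbrs w -> c y = c' y.
  by move=> yw; apply: eqc; apply/bigcupP; exists w.
rewrite (@eq_unhappy c c') ?eqw ?setU11 // => y wy.
by apply: eqw; rewrite !inE wy orbT.
Qed.

Lemma card_bigcup_le (L D : nat) (S : {set G}) (F : G -> {set G}) :
  #|S| <= L -> (forall w, w \in S -> #|F w| <= D) ->
  #|\bigcup_(w in S) F w| <= L * D.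
Proof.
move=> SL FD; apply: leq_trans (leq_mul SL (leqnn D)).
rewrite -sum_nat_const; elim/big_rec2: _ => [|y n A yS IH].
  by rewrite cards0.
apply: leq_trans (leq_card_setU _ _) _.
by apply: leq_add => //; apply: FD.
Qed.

Lemma card_nbrs1 d x : max_degree G <= d -> #|x |: nbrs x| <= d.+1.
Proof.
move=> Gd; apply: leq_trans (leq_card_setU _ _) _.
by rewrite cards1 add1n ltnS; apply: leq_trans (leq_bigmax x) Gd.
Qed.

Lemma card_ball d k u : max_degree G <= d -> #|ball k u| <= d.+1 ^ k.
Proof.
move=> Gd; elim: k => [|k IH] /=; first by rewrite cards1.
rewrite expnSr; apply: card_bigcup_le => // w _; exact: card_nbrs1.
Qed.

(** Bounds how many zones of influence contain a given vertex, without recourse to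
    the symmetry of balls. *)
Lemma card_coball d k w :
  max_degree G <= d -> #|[set v | w \in ball k v]| <= d.+1 ^ k.
Proof.
move=> Gd; elim: k w => [|k IH] w /=.
  rewrite (_ : [set _ | _] = [set w]) ?cards1 //.
  by apply/setP => v; rewrite !inE eq_sym.
apply: (@leq_trans #|\bigcup_(z in w |: nbrs w) [set v | z \in ball k v]|).
  apply: subset_leq_card; apply/subsetP => v; rewrite inE.
  case/bigcupP => z zB wz; apply/bigcupP; exists z; last by rewrite inE.
  by move: wz; rewrite !inE adj_sym eq_sym.
rewrite expnS; apply: card_bigcup_le => // ; exact: card_nbrs1.
Qed.

End Dynamics.
(** * Random seeds *)

Section Seeds.

Variables (G : sgraph) (e : bool) (lab : G -> nat) (d : nat).
Hypothesis Gd : max_degree G <= d.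
Local Notation seed := {ffun G -> bool}.
Implicit Types (s : seed) (c : G -> bool) (u v x y : G).

Definition spin c x : int := (-1) ^+ c x.

Lemma imbalance_spin c : ((imbalance c)%:R ^+ 2 = (\sum_x spin c x) ^+ 2 :> int)%R.
Proof.
have -> : (\sum_x spin c x = (red (fun x => ~~ c x))%:R - (red c)%:R)%R.
  rewrite /red -!sum1_card !natr_sum.
  rewrite [X in (X - _)%R]big_mkcond [X in (_ - X)%R]big_mkcond /= -sumrB.
  by apply: eq_bigr => x _; rewrite !inE /spin; case: (c x).
by rewrite /imbalance; nia.
Qed.

Definition flip (D : {set G}) s : seed :=
  [ffun x => (x \in D) (+) s x].

Lemma flipK D : involutive (flip D).
Proof. by move=> s; apply/ffunP => x; rewrite !ffunE addbA addbb. Qed.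

Lemma card_seeds : #|seed| = 2 ^ #|G|.
Proof. by rewrite card_ffun card_bool. Qed.

(** Complementing the seed on the whole zone of influence of [u] negates the
    spin of [u] and cannot be noticed at [v]. *)
Lemma spins_uncorrelated ls u v :
  [disjoint ball (size ls) u & ball (size ls) v] ->
  (\sum_(s : seed) spin (sweep e lab ls s) u * spin (sweep e lab ls s) v = 0)%R.
Proof.
move=> uv; set S := (\sum_(s : seed) _)%R.
suff : (S = - S)%R by lia.
rewrite {1}/S (reindex_inj (inv_inj (flipK (ball (size ls) u)))) -sumrN.
apply: eq_bigr => s _; set s' := flip _ s.
have eqv : sweep e lab ls s' v = sweep e lab ls s v.
  apply: sweep_local => x xv; rewrite ffunE.
  by rewrite (disjointFl uv xv).
have equ : sweep e lab ls s' u = ~~ sweep e lab ls s u.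
  rewrite -sweepN; apply: sweep_local => x xu.
  by rewrite ffunE xu.
by rewrite /spin eqv equ; case: (sweep _ _ _ s u); case: (sweep _ _ _ s v).
Qed.

Lemma spin_mul_le1 c x y : (spin c x * spin c y <= 1)%R.
Proof. by rewrite /spin; case: (c x); case: (c y). Qed.

Lemma card_meeting k u :
  #|[set v | ~~ [disjoint ball k u & ball k v]]| <= d.+1 ^ k * d.+1 ^ k.
Proof.
apply: (@leq_trans #|\bigcup_(w in ball k u) [set v | w \in ball k v]|).
  apply: subset_leq_card; apply/subsetP => v; rewrite inE.
  case/pred0Pn => w /andP[wu wv]; apply/bigcupP; exists w => //.
  by rewrite inE.
apply: card_bigcup_le; first exact: card_ball.
by move=> w _; apply: card_coball.
Qed.

(** Only the pairs whose zones of influence meet contribute, and each vertex has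
    boundedly many such partners. *)
Lemma imbalance_second_moment ls :
  \sum_(s : seed) imbalance (sweep e lab ls s) ^ 2 <=
    2 ^ #|G| * (#|G| * (d.+1 ^ size ls * d.+1 ^ size ls)).
Proof.
set L := d.+1 ^ size ls * d.+1 ^ size ls.
have : ((\sum_(s : seed) imbalance (sweep e lab ls s) ^ 2)%:R <=
        (2 ^ #|G| * (#|G| * L))%:R :> int)%R; last by lia.
rewrite natr_sum.
pose meet u v := ~~ [disjoint ball (size ls) u & ball (size ls) v].
apply: (@le_trans _ _ (\sum_(u : G) \sum_(v : G) 2 ^+ #|G| * (meet u v)%:R)%R).
  under eq_bigr => s _.
    rewrite natrX imbalance_spin expr2 mulr_suml.
    under eq_bigr do rewrite mulr_sumr.
    over.
  rewrite exchange_big; apply: ler_sum => u _.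
  rewrite exchange_big; apply: ler_sum => v _.
  rewrite /meet; case: (boolP [disjoint _ & _]) => [uv|_].
    by rewrite spins_uncorrelated // mulr0.
  rewrite mulr1 (_ : (2 ^+ #|G| = \sum_(s : seed) 1)%R); last first.
    by rewrite sumr_const card_seeds natrX.
  by apply: ler_sum => s _; apply: spin_mul_le1.
rewrite natrM natrX.
under eq_bigr do rewrite -mulr_sumr.
rewrite -mulr_sumr ler_wpM2l ?exprn_ge0 //.
rewrite -sum_nat_const natr_sum; apply: ler_sum => u _.
rewrite -natr_sum ler_nat; apply: leq_trans (card_meeting (size ls) u).
rewrite -sum1_card [in leqRHS]big_mkcond; apply: leq_sum => v _.
by rewrite inE -/(meet u v); case: (meet u v).
Qed.

Lemma markov (f : seed -> nat) (B K : nat) :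
  0 < B -> \sum_(s : seed) f s <= 2 ^ #|G| * B ->
  K * #|[set s : seed | K * B < f s]| <= 2 ^ #|G|.
Proof.
move=> B0 fB; rewrite -(leq_pmul2r B0); apply: leq_trans fB.
apply: (@leq_trans (\sum_(s in [set s : seed | K * B < f s]) K * B)).
  by rewrite sum_nat_const; lia.
rewrite big_mkcond; apply: leq_sum => s _.
by rewrite inE; case: ltnP => // /ltnW.
Qed.

Hypothesis lab_proper : proper lab.

Lemma moves_cat ls ls' c :
  moves e lab (ls ++ ls') c =
  moves e lab ls c + moves e lab ls' (sweep e lab ls c).
Proof. by elim: ls c => [|l ls IH] c //=; rewrite IH addnA. Qed.

Definition rounds (j : nat) (ls : seq nat) : seq nat := flatten (nseq j ls).

Lemma roundsS j ls : rounds j.+1 ls = rounds j ls ++ ls.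
Proof.
elim: j => [|j IH]; first by rewrite /rounds /= cats0.
by rewrite -[LHS]/(ls ++ rounds j.+1 ls) {1}IH catA.
Qed.

Lemma size_rounds j ls : size (rounds j ls) = j * size ls.
Proof. by elim: j => [|j IH] //=; rewrite size_cat IH. Qed.

(** The rounds share a single budget: the potential grows with every move and
    never exceeds [#|G| * d]. *)
Lemma sum_round_moves T ls c :
  \sum_(j < T) moves e lab ls (sweep e lab (rounds j ls) c) <= #|G| * d.
Proof.
have -> : \sum_(j < T) moves e lab ls (sweep e lab (rounds j ls) c) =
          moves e lab (rounds T ls) c.
  elim: T => [|T IH]; first by rewrite big_ord0.
  by rewrite big_ord_recr IH roundsS moves_cat.
apply: leq_trans (potential_le e (sweep e lab (rounds T ls) c) Gd).
by apply: leq_trans (potential_sweep e lab_proper _ c); rewrite leq_addl.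
Qed.

(** Pigeonhole on the budget averaged over the seeds. The round is the same for
    all seeds, so that its colouring keeps the symmetry of the dynamics. *)
Lemma calm_round T ls :
  0 < T -> exists2 j, j < T &
  \sum_(s : seed) T * moves e lab ls (sweep e lab (rounds j ls) s)
    <= 2 ^ #|G| * (#|G| * d).
Proof.
move=> T0; pose F (j : 'I_T) := \sum_(s : seed) moves e lab ls (sweep e lab (rounds j ls) s).
have FT : \sum_j F j <= 2 ^ #|G| * (#|G| * d).
  rewrite exchange_big -card_seeds -sum_nat_const.
  by apply: leq_sum => s _; apply: sum_round_moves.
have [j _ Fj] := @arg_minnP _ (Ordinal T0) xpredT F isT.
exists j => //; rewrite -big_distrr /=; apply: leq_trans FT.
rewrite -[T in T * _]card_ord -sum_nat_const.
by apply: leq_sum => i _; apply: Fj.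
Qed.

(** The requirement bears on all recolourings that can balance [c], since the
    algorithm picks one according to the order of its input. *)
Definition rebalances_well (a b : nat) c : Prop :=
  forall c', 2 * #|differ c c'| <= imbalance c -> b * bad e c' <= a * #|G|.

(** At most a quarter of the seeds make many moves in the calm round, by Markov's
    inequality, and at most a quarter have a large imbalance after it, by
    Chebyshev's. The threshold on [#|G|] makes [sqrt #|G|] dominate the constants
    produced by the latter. *)
Lemma half_of_seeds_rebalance_well (q : nat) (ls : seq nat)
    (T := 8 * (q.+1 * (d.+1 * d.+1))) (L := d.+1 ^ (T * size ls)) :
  (forall x, lab x \in ls) ->
  16 * (q.+1 * d.+1 * (q.+1 * d.+1) * (L * L)) < #|G| ->
  exists (j : nat) (A : {set seed}),
    [/\ j <= T, 2 ^ #|G| <= 2 * #|A| &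
        forall s, s \in A -> rebalances_well 1 q.+1 (sweep e lab (rounds j ls) s)].
Proof.
move=> labs nL; have T0 : 0 < T by rewrite /T !muln_gt0.
have n0 : 0 < #|G| by apply: leq_ltn_trans nL.
have [j jT moves_j] := calm_round ls T0.
pose A1 := [set s : seed | 4 * (#|G| * d.+1) <
  T * moves e lab ls (sweep e lab (rounds j ls) s)].
pose X s := imbalance (sweep e lab (rounds j.+1 ls) s).
pose A2 := [set s : seed | 4 * (#|G| * (L * L)) < X s ^ 2].
have A1_le : 4 * #|A1| <= 2 ^ #|G|.
  apply: markov; first by rewrite muln_gt0 n0.
  by apply: leq_trans moves_j _; rewrite !leq_mul2l ?leqnSn ?orbT.
have L_le : d.+1 ^ size (rounds j.+1 ls) <= L.
  by rewrite size_rounds; apply: leq_pexp2l => //; rewrite leq_mul2r jT orbT.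
have A2_le : 4 * #|A2| <= 2 ^ #|G|.
  apply: markov; first by rewrite !muln_gt0 n0 expn_gt0.
  apply: leq_trans (imbalance_second_moment (rounds j.+1 ls)) _.
  by rewrite !leq_mul2l (leq_mul L_le L_le) !orbT.
exists j.+1, (~: (A1 :|: A2)); split=> //.
  have U_le : #|A1 :|: A2| <= #|A1| + #|A2| := leq_card_setU A1 A2.
  have := cardsC (A1 :|: A2); rewrite card_seeds.
  by move: A1_le A2_le U_le; move: (2 ^ #|G|) #|~: _| #|_ :|: _| #|A1| #|A2|; lia.
move=> s; rewrite !inE negb_or -!leqNgt => /andP[sA1 sA2] c' cc'.
set c := sweep e lab (rounds j.+1 ls) s in cc'.
set F := moves _ _ _ _ in sA1.
have bad_c : bad e c <= d * F.
  by rewrite /c roundsS sweep_cat; apply: bad_sweep.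
have := bad_differ e c c' Gd; set D := #|_| in cc' *.
rewrite mul1n => bad_c'.
(* each of the two sources of unhappy vertices takes half of the budget *)
have halfF : 2 * (q.+1 * (d * F)) <= #|G|.
  have : 8 * (q.+1 * d.+1 * F) * d.+1 <= 4 * #|G| * d.+1.
    by move: sA1; rewrite /T; lia.
  rewrite leq_pmul2r // => ?; suff : q.+1 * (d * F) <= q.+1 * d.+1 * F by lia.
  by rewrite -mulnA leq_mul // leq_mul.
have halfX : 2 * (q.+1 * d.+1 * X s) <= #|G|.
  rewrite -leq_sqr; apply: (@leq_trans (4 * (q.+1 * d.+1 * (q.+1 * d.+1)) * X s ^ 2)).
    by rewrite !expnS !expn0; lia.
  apply: (@leq_trans (4 * (q.+1 * d.+1 * (q.+1 * d.+1)) * (4 * (#|G| * (L * L))))).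
    by rewrite leq_mul2l sA2 orbT.
  rewrite expnS expn1; apply: leq_trans (leq_mul (ltnW nL) (leqnn #|G|)).
  by apply: eq_leq; ring.
have : q.+1 * bad e c' <= q.+1 * (d * F) + q.+1 * (d.+1 * D).
  by rewrite -mulnDr leq_mul2l; apply: leq_trans bad_c' _; rewrite leq_add2r.
have : q.+1 * (d.+1 * D) <= q.+1 * d.+1 * X s.
  by rewrite mulnA leq_mul2l; apply/orP; right; rewrite /X -/c; lia.
by move: halfF halfX; lia.
Qed.

End Seeds.
(** * Executions of programs *)

Section Cost.

Variable R : realType.
Local Open Scope ring_scope.

(** The expectation of the running time truncated at [t], by the recursion on the
    first coin that program logic needs. *)
Fixpoint cost (t : nat) (s : config) : R :=
  if t is t'.+1 then
    if halted s then 0 else 1 + (cost t' (step true s) + cost t' (step false s)) / 2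
  else 0.

Fixpoint avg (n : nat) (f : seq bool -> R) : R :=
  if n is n'.+1 then
    (avg n' (fun w => f (true :: w)) + avg n' (fun w => f (false :: w))) / 2
  else f [::].

Lemma sum_tupleS n (f : seq bool -> R) :
  \sum_(w : n.+1.-tuple bool) f w =
  \sum_(w : n.-tuple bool) f (true :: w) + \sum_(w : n.-tuple bool) f (false :: w).
Proof.
rewrite (reindex (fun p : bool * n.-tuple bool => [tuple of p.1 :: p.2])) /=.
  rewrite -(pair_big xpredT xpredT (fun b (w : n.-tuple bool) => f (b :: w))) /=.
  by rewrite big_bool.
exists (fun w => (thead w, behead_tuple w)) => [[b w] _|w _].
  by rewrite theadE; congr (_, _); apply: val_inj.
by rewrite [RHS]tuple_eta; apply: val_inj.
Qed.

Lemma avgE n (f : seq bool -> R) :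
  avg n f = (\sum_(w : n.-tuple bool) f w) / 2%:R ^+ n.
Proof.
elim: n f => [|n IH] f /=.
  rewrite (big_pred1 [tuple]) ?expr0 ?divr1 // => w.
  by apply/esym/eqP; rewrite (tuple0 w); apply: val_inj.
by rewrite !IH sum_tupleS exprS; field; rewrite expf_neq0 // pnatr_eq0.
Qed.

Lemma avg_affine n (a b : R) (f : seq bool -> R) :
  avg n (fun w => a + b * f w) = a + b * avg n f.
Proof. by elim: n f => [|n IH] f //=; rewrite !IH; field. Qed.

Lemma cost_avg t s : cost t s = avg t (fun w => (runtime w s)%:R).
Proof.
elim: t s => [|t IH] s //=; case: ifP => _.
  elim: t {IH s} => [|t IH] /=; first by rewrite addr0 mul0r.
  by rewrite -IH; lra.
have avg1 b : avg t (fun w => (runtime w (step b s)).+1%:R) = 1 + cost t (step b s).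
  rewrite IH -[X in 1 + X]mul1r -avg_affine; congr avg; apply/funext => w.
  by rewrite mul1r -natr1 addrC.
by rewrite !avg1; lra.
Qed.

Lemma truncated_expected_runtimeE s t :
  truncated_expected_runtime R s t = cost t s.
Proof. by rewrite cost_avg avgE. Qed.

Lemma cost_ge0 t s : 0 <= cost t s.
Proof.
elim: t s => [|t IH] s //=; case: ifP => // _.
by have := IH (step true s); have := IH (step false s); lra.
Qed.

Lemma cost_pred t s : cost t s <= cost t.+1 s.
Proof.
elim: t s => [|t IH] s; first exact: cost_ge0.
rewrite [cost t.+1 s]/= [cost t.+2 s]/=; case: ifP => // _.
by have := IH (step true s); have := IH (step false s); rewrite /=; lra.
Qed.

(** Expected time and partial correctness obey the same rules, one step at a
    time, so they are bounded together; the horizon [t] makes inductions over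
    unbounded loops possible. *)
Definition within (t : nat) (Q : memory -> Prop) (s : config) (B : R) : Prop :=
  cost t s <= B /\
  forall w : seq bool, (size w <= t)%N -> halted (run w s) -> Q (run w s).2.

Lemma within_weaken t Q s B B' : B <= B' -> within t Q s B -> within t Q s B'.
Proof. by move=> BB' [? ?]; split=> //; apply: le_trans BB'. Qed.

Lemma within_halted t Q m : Q m -> within t Q ([::], m) 0.
Proof.
move=> Qm; split; first by case: t.
by move=> w _; suff -> : run w ([::], m) = ([::], m) by []; elim: w.
Qed.

Lemma within0 (Q : memory -> Prop) s : ~~ halted s -> within 0 Q s 0.
Proof. by move=> ns; split=> // [[|//]] /= _; rewrite (negbTE ns). Qed.

Lemma within_stepS t Q s B : ~~ halted s ->
  (forall b, within t Q (step b s) (B b)) ->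
  within t.+1 Q s (1 + (B true + B false) / 2).
Proof.
move=> ns sB; split.
  rewrite /= (negbTE ns).
  by have [Bt _] := sB true; have [Bf _] := sB false; lra.
case=> [|b w] /= sz; first by rewrite (negbTE ns).
by have [_ Qb] := sB b; apply: Qb.
Qed.

Lemma within_step t Q s B : ~~ halted s ->
  (forall b, within t Q (step b s) (B b)) ->
  within t Q s (1 + (B true + B false) / 2).
Proof.
move=> ns /(within_stepS ns) [cB Qw]; split.
  exact: le_trans (cost_pred _ _) cB.
by move=> w /leqW; apply: Qw.
Qed.

End Cost.

(** ** Deterministic stretches *)

Fixpoint dsteps (n : nat) (s s' : config) : Prop :=
  if n is n'.+1 then
    [/\ ~~ halted s, step true s = step false s & dsteps n' (step true s) s']
  else s = s'.

Lemma dsteps_trans n1 n2 s1 s2 s3 :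
  dsteps n1 s1 s2 -> dsteps n2 s2 s3 -> dsteps (n1 + n2) s1 s3.
Proof.
elim: n1 s1 => [|n1 IH] s1 /=; first by move=> ->.
by case=> ? ? s12 s23; split=> //; apply: IH s12 s23.
Qed.

(** The same coin-free execution in front of any continuation: a total-correctness
    triple with a time bound. *)
Definition runs (c : cmd) (m : memory) (B : nat) (Q : memory -> Prop) : Prop :=
  exists n m', [/\ n <= B, forall k, dsteps n (c :: k, m) (k, m') & Q m'].

Lemma within_runs (R : realType) t c m B Q Q' k (E : R) :
  runs c m B Q ->
  (forall m', Q m' -> within t Q' (k, m') E) ->
  within t Q' (c :: k, m) (B%:R + E)%R.
Proof.
case=> n [m' [nB steps Qm']] /(_ _ Qm') wE.
apply: (@within_weaken R t Q' _ (n%:R + E)%R); first by rewrite lerD2r ler_nat.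
elim: n (c :: k, m) {steps nB} (steps k) => [|n IH] s /=.
  by move=> ->; rewrite add0r.
case=> ns tf sn.
rewrite (_ : n.+1%:R + E = 1 + ((n%:R + E) + (n%:R + E)) / 2)%R; last first.
  by rewrite -natr1; lra.
apply: (@within_step R t Q' s (fun=> n%:R + E)%R ns) => b.
by case: b; rewrite -?tf; apply: IH.
Qed.

Lemma runs_weaken c m B B' (Q Q' : memory -> Prop) :
  runs c m B Q -> B <= B' -> (forall m', Q m' -> Q' m') -> runs c m B' Q'.
Proof.
case=> n [m' [nB steps Qm']] BB' QQ'; exists n, m'; split=> //; last exact: QQ'.
exact: leq_trans BB'.
Qed.

Lemma runs_seq c1 c2 m B1 B2 (Q1 Q : memory -> Prop) :
  runs c1 m B1 Q1 -> (forall m1, Q1 m1 -> runs c2 m1 B2 Q) ->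
  runs (Seq c1 c2) m (B1 + B2).+1 Q.
Proof.
case=> n1 [m1 [n1B steps1 Qm1]] /(_ _ Qm1) [n2 [m2 [n2B steps2 Qm2]]].
exists (n1 + n2).+1, m2; split=> // [|k]; first by rewrite ltnS leq_add.
by split=> //; apply: dsteps_trans (steps1 _) (steps2 _).
Qed.

Lemma runs_if t c1 c2 m B Q :
  runs (if eval_test m t then c1 else c2) m B Q -> runs (If t c1 c2) m B.+1 Q.
Proof.
by case=> n [m' [nB steps Qm']]; exists n.+1, m'; split=> // k; split=> //; exact: steps.
Qed.

Lemma runs_while_false t c m (Q : memory -> Prop) :
  ~~ eval_test m t -> Q m -> runs (While t c) m 1 Q.
Proof.
by move=> nt Qm; exists 1, m; split=> // k; split=> //=; rewrite (negbTE nt).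
Qed.

Lemma runs_while_true t c m B1 B2 (Q1 Q : memory -> Prop) :
  eval_test m t -> runs c m B1 Q1 ->
  (forall m1, Q1 m1 -> runs (While t c) m1 B2 Q) ->
  runs (While t c) m (B1 + B2).+1 Q.
Proof.
move=> tm [n1 [m1 [n1B steps1 Qm1]]] /(_ _ Qm1) [n2 [m2 [n2B steps2 Qm2]]].
exists (n1 + n2).+1, m2; split=> // [|k]; first by rewrite ltnS leq_add.
split=> //=; rewrite tm; exact: dsteps_trans (steps1 _) (steps2 _).
Qed.

Fixpoint straight (c : cmd) : bool :=
  match c with
  | Flip _ | While _ _ => false
  | Seq c1 c2 | If _ c1 c2 => straight c1 && straight c2
  | _ => true
  end.

(** A denotation for straight-line programs, so that their effect is obtained by
    simplification; [Flip] and [While] get dummy values. *)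
Fixpoint exec (c : cmd) (m : memory) : memory :=
  match c with
  | Skip | Flip _ | While _ _ => m
  | Const x v => set_reg m x v
  | Copy x y => set_reg m x (reg m y)
  | Inc x => set_reg m x (reg m x).+1
  | Dec x => set_reg m x (reg m x).-1
  | Get x a y => set_reg m x (arr m a (reg m y))
  | Put a x y => set_arr m a (reg m x) (reg m y)
  | Seq c1 c2 => exec c2 (exec c1 m)
  | If t c1 c2 => if eval_test m t then exec c1 m else exec c2 m
  end.

Fixpoint len (c : cmd) : nat :=
  match c with
  | Seq c1 c2 | If _ c1 c2 => (len c1 + len c2).+1
  | _ => 1
  end.

Lemma runs_straight c m (Q : memory -> Prop) :
  straight c -> Q (exec c m) -> runs c m (len c) Q.
Proof.
elim: c m Q => //=; try by move=> *; eexists 1, _; split=> // k; split.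
  move=> c1 IH1 c2 IH2 m Q /andP[s1 s2] Qm.
  apply: runs_seq; first by apply: IH1 => //; exact: erefl.
  by move=> m1 <-; apply: IH2.
move=> t c1 IH1 c2 IH2 m Q /andP[s1 s2] Qm; apply: runs_if.
move: Qm; case: (eval_test m t) => Qm.
  by apply: runs_weaken (IH1 _ _ s1 Qm) (leq_addr _ _) _.
by apply: runs_weaken (IH2 _ _ s2 Qm) (leq_addl _ _) _.
Qed.

(** ** What a program leaves untouched *)

Fixpoint wregs (c : cmd) : seq nat :=
  match c with
  | Const x _ | Copy x _ | Inc x | Dec x | Get x _ _ | Flip x => [:: x]
  | Seq c1 c2 | If _ c1 c2 => wregs c1 ++ wregs c2
  | While _ c1 => wregs c1
  | _ => [::]
  end.

Fixpoint warrs (c : cmd) : seq nat :=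
  match c with
  | Put a _ _ => [:: a]
  | Seq c1 c2 | If _ c1 c2 => warrs c1 ++ warrs c2
  | While _ c1 => warrs c1
  | _ => [::]
  end.

Definition frame (c : cmd) (m m' : memory) : Prop :=
  (forall x, x \notin wregs c -> reg m' x = reg m x) /\
  (forall a, a \notin warrs c -> arr m' a = arr m a).

Lemma frame_trans c m1 m2 m3 : frame c m1 m2 -> frame c m2 m3 -> frame c m1 m3.
Proof.
by case=> r12 a12 [r23 a23]; split=> z zc; rewrite ?r23 ?a23 ?r12 ?a12.
Qed.

Lemma step_reg x b s :
  all (fun c => x \notin wregs c) s.1 ->
  all (fun c => x \notin wregs c) (step b s).1 /\ reg (step b s).2 x = reg s.2 x.
Proof.
case: s => -[|c k] m //= /andP[xc xk].
case: c xc => //=; try by move=> *; split=> //=; rewrite /upd;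
  case: eqP => // x_eq; move: (xc); rewrite ?inE x_eq ?eqxx.
all: try by move=> y; rewrite inE => xy; split=> //=; rewrite /upd (negbTE xy).
all: try by move=> y z; rewrite inE => xy; split=> //=; rewrite /upd (negbTE xy).
all: try by move=> y z u; rewrite inE => xy; split=> //=; rewrite /upd (negbTE xy).
- by move=> c1 c2; rewrite mem_cat negb_or xk => /andP[-> ->].
- by move=> t c1 c2; rewrite mem_cat negb_or => /andP[c1x c2x];
    case: (eval_test m t); rewrite xk ?c1x ?c2x.
- by move=> t c1 c1x; case: (eval_test m t); rewrite /= ?xk ?c1x.
Qed.

Lemma step_arr a b s :
  all (fun c => a \notin warrs c) s.1 ->
  all (fun c => a \notin warrs c) (step b s).1 /\ arr (step b s).2 a = arr s.2 a.
Proof.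
case: s => -[|c k] m //= /andP[ac ak].
case: c ac => //=.
- by move=> y z u; rewrite inE => xy; split=> //=; rewrite /upd (negbTE xy).
- by move=> c1 c2; rewrite mem_cat negb_or ak => /andP[-> ->].
- by move=> t c1 c2; rewrite mem_cat negb_or => /andP[c1x c2x];
    case: (eval_test m t); rewrite ak ?c1x ?c2x.
- by move=> t c1 c1x; case: (eval_test m t); rewrite /= ?ak ?c1x.
Qed.

(** Specifications can thus speak of what a program computes, and leave what it
    preserves to the syntactic lists of written registers and arrays. *)
Lemma runs_frame c m B Q :
  runs c m B Q -> runs c m B (fun m' => Q m' /\ frame c m m').
Proof.
case=> n [m' [nB steps Qm']]; exists n, m'; split=> //; split=> //.
move: (steps [::]) => {nB Qm'} {}steps; split=> z zc.
- have: all (fun c => z \notin wregs c) ([:: c], m).1 by rewrite /= zc.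
  rewrite -[in RHS]/([:: c], m).2; elim: n ([:: c], m) steps => [|n IH] s /=.
    by move=> ->.
  by case=> _ _ sn /(step_reg true)[zs <-]; apply: IH.
- have: all (fun c => z \notin warrs c) ([:: c], m).1 by rewrite /= zc.
  rewrite -[in RHS]/([:: c], m).2; elim: n ([:: c], m) steps => [|n IH] s /=.
    by move=> ->.
  by case=> _ _ sn /(step_arr true)[zs <-]; apply: IH.
Qed.
(** ** Loops *)

Local Notation "c1 ;; c2" := (Seq c1 c2) (at level 60, right associativity).

Lemma runs_for x y body (I : nat -> memory -> Prop) lo hi m B :
  (forall i m', I i m' -> reg m' x = i /\ reg m' y = hi) ->
  (forall i m', i < hi -> I i m' -> runs (body ;; Inc x) m' B (I i.+1)) ->
  lo <= hi -> I lo m ->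
  runs (While (TestLt x y) (body ;; Inc x)) m ((hi - lo) * B.+1).+1 (I hi).
Proof.
move=> Ireg Ibody; have [r lo_r] : {r | hi - lo = r} by exists (hi - lo).
rewrite lo_r; elim: r lo m lo_r => [|r IH] lo m.
  move=> lo_r lohi Ilo; have lo_hi : lo = hi by lia.
  have [rx ry] := Ireg _ _ Ilo; rewrite -lo_hi mul0n.
  by apply: runs_while_false; rewrite //= rx ry lo_hi ltnn.
move=> lo_r lohi Ilo; have [rx ry] := Ireg _ _ Ilo.
have lt : lo < hi by lia.
apply: (@runs_weaken _ _ (B + (r * B.+1).+1).+1 _ (I hi)); [| by lia | by []].
apply: runs_while_true (Ibody _ _ lt Ilo) _; first by rewrite /= rx ry.
by move=> m1 Im1; apply: (IH lo.+1) => //; lia.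
Qed.

(** The coins serve in the order of the cells, at fixed times, so the expected cost
    of what follows is averaged over independent uniform cells. *)
Lemma cost_fill_loop (R : realType) t Q a k (r i : nat) m (B : seq bool -> R) :
  reg m 1 = i -> i + r = reg m 0 ->
  (forall w m', size w = r ->
     (forall j, j < i -> arr m' a j = arr m a j) ->
     (forall j, j < r -> arr m' a (i + j) = nth false w j) ->
     (forall x : nat, x \notin [:: 1; 4] -> reg m' x = reg m x) ->
     (forall b : nat, b != a -> arr m' b = arr m b) ->
     within t Q (k, m') (B w)) ->
  within t Q (While (TestLt 1 0) (Flip 4 ;; Put a 1 4 ;; Inc 1) :: k, m)
    ((6 * r + 1)%:R + avg r B)%R.
Proof.
elim: r i m B => [|r IH] i m B ri ir post.
  apply: (@within_runs _ _ _ _ 1 (fun m' => m' = m)) => [|_ ->].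
    by apply: runs_while_false => //=; rewrite ri; lia.
  by apply: post.
have lt : i < reg m 0 by lia.
set loop := While _ _.
pose C b : R := ((6 * r + 1)%:R + avg r (fun w => B (b :: w)))%R.
pose m1 (b : bool) := set_reg (set_arr (set_reg m 4 b) a i b) 1 i.+1.
have wC b : within t Q (loop :: k, m1 b) (C b).
  apply: (IH i.+1) => //; first by rewrite /= /upd /=; lia.
  move=> w m' szw below above regs arrs; apply: post.
  - by rewrite /= szw.
  - move=> j ji; rewrite below ?leqW //= /upd eqxx /=.
    by rewrite ltn_eqF.
  - case=> [_|j jr].
      by rewrite addn0 below //= /upd !eqxx.
    by rewrite addnS -addSn above.
  - move=> x xn; rewrite regs //=; move: xn; rewrite /upd !inE negb_or.
    by case/andP => /negbTE -> /negbTE ->.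
  - by move=> b' ba; rewrite arrs //= /upd (negbTE ba).
have wD (b : bool) : within t Q ([:: Put a 1 4 ;; Inc 1, loop & k], set_reg m 4 b)
              (3%:R + C b)%R.
  apply: (@within_runs _ _ _ _ 3 (fun m' => m' = m1 b)) => [|_ ->]; last exact: wC.
  by apply: runs_straight => //=; rewrite /m1 /set_reg /set_arr /= /upd /= ri.
have wE : within t Q (Flip 4 :: (Put a 1 4 ;; Inc 1) :: loop :: k, m)
             (1 + ((3%:R + C true) + (3%:R + C false)) / 2)%R.
  exact: (within_step (s := (Flip 4 :: (Put a 1 4 ;; Inc 1) :: loop :: k, m))
    (B := fun b => 3%:R + C b)%R).
have wF : within t Q ((Flip 4 ;; Put a 1 4 ;; Inc 1) :: loop :: k, m)
   (1 + ((1 + ((3%:R + C true) + (3%:R + C false)) / 2) +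
        (1 + ((3%:R + C true) + (3%:R + C false)) / 2)) / 2)%R.
  exact: (within_step (s := ((Flip 4 ;; Put a 1 4 ;; Inc 1) :: loop :: k, m))
    (B := fun=> 1 + ((3%:R + C true) + (3%:R + C false)) / 2)%R).
have := within_step (s := (loop :: k, m)) (t := t) (Q := Q)
  (B := fun=> (1 + ((1 + ((3%:R + C true) + (3%:R + C false)) / 2) +
        (1 + ((3%:R + C true) + (3%:R + C false)) / 2)) / 2)%R) isT.
rewrite /= ri lt => /(_ (fun=> wF)); apply: within_weaken.
by rewrite /C mulnS !natrD /=; lra.
Qed.

Definition fill (a : nat) : cmd :=
  Const 1 0 ;; While (TestLt 1 0) (Flip 4 ;; Put a 1 4 ;; Inc 1).

Lemma cost_fill (R : realType) t Q a k n m (B : seq bool -> R) :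
  reg m 0 = n ->
  (forall w m', size w = n ->
     (forall j, j < n -> arr m' a j = nth false w j) ->
     (forall x : nat, x \notin [:: 1; 4] -> reg m' x = reg m x) ->
     (forall b : nat, b != a -> arr m' b = arr m b) ->
     within t Q (k, m') (B w)) ->
  within t Q (fill a :: k, m) ((6 * n + 3)%:R + avg n B)%R.
Proof.
move=> rn post; set loop := While (TestLt 1 0) (Flip 4 ;; Put a 1 4 ;; Inc 1).
have wA : within t Q (loop :: k, set_reg m 1 0) ((6 * n + 1)%:R + avg n B)%R.
  apply: cost_fill_loop => //= w m' szw _ val regs arrs; apply: post => // x xn.
  by rewrite regs //= /upd; move: xn; rewrite !inE negb_or => /andP[/negbTE ->].
have wB : within t Q (Const 1 0 :: loop :: k, m) (1%:R + ((6 * n + 1)%:R + avg n B))%R.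
  by apply: (@within_runs _ _ _ _ 1 (fun m' => m' = set_reg m 1 0)) => [|_ ->//];
    apply: runs_straight.
have := within_step (s := (fill a :: k, m)) (t := t) (Q := Q)
  (B := fun=> 1%:R + ((6 * n + 1)%:R + avg n B))%R isT (fun=> wB).
by apply: within_weaken; rewrite !natrD /=; lra.
Qed.

(** An attempt costs at most [K = 6 * n + Bd + 6] steps and succeeds with
    probability at least [1 / P] whatever happened before. So [P * K] satisfies
    [K + (1 - 1 / P) * (P * K) <= P * K], which makes it a super-solution of the
    recursion for the expected time, and it bounds all truncations. *)
Lemma las_vegas (R : realType) (Q Inv : memory -> Prop) (body : cmd)
    (n Bd P : nat) (S : pred (seq bool)) :
  (1 <= P%:R * avg n (fun w => (S w)%:R) :> R)%R ->
  (forall m, Inv m -> reg m 0 = n /\ reg m 9 = 0) ->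
  (forall m m' w, Inv m -> reg m 15 = 0 -> size w = n ->
     (forall j, j < n -> arr m' 4 j = nth false w j) ->
     (forall x : nat, x \notin [:: 1; 4] -> reg m' x = reg m x) ->
     (forall b : nat, b != 4 -> arr m' b = arr m b) ->
     runs body m' Bd (fun m'' => [/\ Inv m'',
       (reg m'' 15 != 0 -> Q m'') & (S w -> reg m'' 15 != 0)])) ->
  forall t m, Inv m -> reg m 15 = 0 ->
  within t Q ([:: While (TestEq 15 9) (fill 4 ;; body)], m)
    ((P * (6 * n + Bd + 6))%:R : R)%R.
Proof.
move=> PS Ireg attempt; set loop := While _ _; set E : R := (P * _)%:R%R.
elim=> [|t IH] m Im m15.
  by apply: within_weaken (within0 _ _ _); rewrite ?ler0n.
have [m0 m9] := Ireg m Im.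
pose B w : R := (Bd%:R + (1 + (if S w then 0 else E)))%R.
have E0 : (0 <= E)%R by rewrite ler0n.
have wA : within t Q ([:: fill 4; body; loop], m) ((6 * n + 3)%:R + avg n B)%R.
  apply: cost_fill => // w m' szw val regs arrs.
  apply: within_runs (attempt m m' w Im m15 szw val regs arrs) _.
  move=> m'' [Im'' good Sw]; case: (eqVneq (reg m'' 15) 0) => [m''15|m''15].
    have -> : S w = false by apply/negP => /Sw; rewrite m''15.
    by apply: within_weaken (IH m'' Im'' m''15); rewrite lerDr ler01.
  have [_ m''9] := Ireg m'' Im''.
  have wH : within t Q ([::], m'') (0 : R)%R by apply: within_halted; apply: good.
  have := within_step (R := R) (s := ([:: loop], m'')) (t := t) (Q := Q)
    (B := fun=> 0%R) isT.
  rewrite /= m''9 (negbTE m''15) => /(_ (fun=> wH)); apply: within_weaken.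
  by case: (S w); rewrite /=; lra.
have wB : within t Q ([:: fill 4 ;; body; loop], m)
    (1 + (((6 * n + 3)%:R + avg n B) + ((6 * n + 3)%:R + avg n B)) / 2)%R.
  exact: (within_step (s := ([:: fill 4 ;; body; loop], m))
    (B := fun=> (6 * n + 3)%:R + avg n B)%R).
have := within_stepS (s := ([:: loop], m)) (t := t) (Q := Q)
  (B := fun=> (1 + (((6 * n + 3)%:R + avg n B) + ((6 * n + 3)%:R + avg n B)) / 2)%R) isT.
rewrite /= m15 m9 => /(_ (fun=> wB)); apply: within_weaken.
have -> : avg n B = (Bd%:R + 1 + E - E * avg n (fun w => (S w)%:R))%R.
  rewrite (_ : B = fun w => (Bd%:R + 1 + E) + (- E) * (S w)%:R)%R.
    by rewrite avg_affine; ring.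
  by apply/funext => w; rewrite /B; case: (S w) => /=; lra.
have -> : (E = P%:R * (6 * n + Bd + 6)%:R)%R by rewrite /E natrM.
set p := avg n _ in PS *.
have : ((6 * n + Bd + 6)%:R <= P%:R * (6 * n + Bd + 6)%:R * p)%R.
  by rewrite mulrAC -[leLHS]mul1r ler_wpM2r // ler0n.
by rewrite !natrD /=; lra.
Qed.
(** * The passes of the algorithm *)

Lemma frame_set_reg c r v m : r \in wregs c -> frame c m (set_reg m r v).
Proof.
move=> rc; split=> // x xc /=; rewrite /upd; case: eqP => // x_r.
by move: xc; rewrite x_r rc.
Qed.

Lemma frame_sub c c' m m' :
  {subset wregs c <= wregs c'} -> {subset warrs c <= warrs c'} ->
  frame c m m' -> frame c' m m'.
Proof.
move=> sr sa [fr fa]; split=> z zc.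
  by apply: fr; apply: contra zc => /sr.
by apply: fa; apply: contra zc => /sa.
Qed.

Lemma nth_flatten_shape (ss : seq (seq nat)) i k :
  k < size (nth [::] ss i) ->
  nth 0 (flatten ss) (sumn (take i (shape ss)) + k) = nth 0 (nth [::] ss i) k.
Proof.
elim: ss i => [|s ss IH] [|i] //= lt; first by rewrite nth_cat lt.
by rewrite -addnA nth_cat ltnNge leq_addr /= addKn IH.
Qed.

(** Conventions shared by the programs. Registers: 0 is the order of the graph; 1
    the current vertex; 2 and 3 delimit the adjacency list that remains to be
    read; 4 is the value to which neighbours are compared; 5 and 6 are scratch; 7
    and 8 count the neighbours with an equal and with a different value; 9 is never
    written and stays 0; 11 and 12 count red and blue vertices; 13 and 14 hold the
    two sides of the acceptance inequality; 15 is set upon success. Arrays: 2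
    receives the answer, 3 the labels, 4 the evolving colouring. *)

Definition each_vertex (body : cmd) : cmd :=
  Const 1 0 ;; While (TestLt 1 0) (body ;; Inc 1).

Definition scan (a : nat) : cmd :=
  (Get 2 0 1 ;; Copy 3 1 ;; Inc 3 ;; Get 3 0 3 ;; Const 7 0 ;; Const 8 0) ;;
  While (TestLt 2 3) ((Get 5 1 2 ;; Get 6 a 5 ;; If (TestEq 6 4) (Inc 7) (Inc 8))
    ;; Inc 2).

Definition unhappy_test (e : bool) : test := if e then TestLt 8 7 else TestLt 7 8.

Definition update_vertex (e : bool) (l : nat) : cmd :=
  Get 4 4 1 ;; scan 4 ;;
  If (unhappy_test e)
    (Get 5 3 1 ;; Const 6 l ;;
     If (TestEq 5 6) (If (TestEq 4 9) (Const 4 1) (Const 4 0) ;; Put 4 1 4) Skip)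
    Skip.

Definition label_vertex (l : nat) : cmd :=
  Const 4 l ;; scan 3 ;; Get 5 3 1 ;;
  If (TestEq 5 9) (If (TestEq 7 9) (Put 3 1 4) Skip) Skip.

Definition tally : cmd :=
  (Const 11 0 ;; Const 12 0) ;;
  each_vertex (Get 4 4 1 ;; If (TestEq 4 9) (Inc 12) (Inc 11)).

Definition balance_vertex : cmd :=
  Get 4 4 1 ;;
  If (TestEq 4 9)
    (Copy 5 11 ;; Inc 5 ;; If (TestLt 5 12) (Const 4 1 ;; Inc 11 ;; Dec 12) Skip)
    (Copy 5 12 ;; Inc 5 ;; If (TestLt 5 11) (Const 4 0 ;; Dec 11 ;; Inc 12) Skip) ;;
  Put 2 1 4.

Definition incs (k x : nat) : cmd := iter k (Seq (Inc x)) Skip.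

Definition check_vertex (e : bool) (a b : nat) : cmd :=
  Get 4 2 1 ;; scan 2 ;; incs a 13 ;; If (unhappy_test e) (incs b 14) Skip.

(** The inequality [b * bad e c <= a * n] is tested by counting up both sides, as
    the machine has no multiplication. *)
Definition check (e : bool) (a b : nat) : cmd :=
  (Const 13 0 ;; Const 14 0) ;; each_vertex (check_vertex e a b) ;;
  If (TestLt 13 14) Skip (Const 15 1).

Lemma wregs_incs k x : wregs (incs k x) = nseq k x.
Proof. by elim: k => //= k ->. Qed.

Lemma warrs_incs k x : warrs (incs k x) = [::].
Proof. by elim: k. Qed.

Lemma straight_incs k x : straight (incs k x).
Proof. by elim: k. Qed.

Lemma len_incs k x : len (incs k x) = 2 * k + 1.
Proof. by elim: k => //= k ->; lia. Qed.

Lemma reg_incs k x m y :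
  reg (exec (incs k x) m) y = reg m y + (if y == x then k else 0).
Proof.
elim: k m => [|k IH] m /=; first by rewrite if_same addn0.
by rewrite IH /= /upd; case: eqP => // ->; rewrite addSnnS.
Qed.

Section Passes.

Variables (G : sgraph) (vs : seq G) (nb : G -> seq G) (d : nat).
Hypothesis pres : presentation vs nb.
Hypothesis Gd : max_degree G <= d.
Implicit Types (m : memory) (x y : G) (g : G -> nat) (c h : G -> bool).

Notation ix x := (index x vs).

Lemma size_vs : size vs = #|G|.
Proof. by rewrite (perm_size pres.1) cardE. Qed.

Lemma mem_vs x : x \in vs.
Proof. by rewrite (perm_mem pres.1) mem_enum. Qed.

Lemma ix_lt x : ix x < size vs.
Proof. by rewrite index_mem mem_vs. Qed.

Lemma ix_eq x y : (ix x == ix y) = (x == y).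
Proof.
by apply/eqP/eqP => [|->//]; apply: (index_inj x); rewrite mem_vs.
Qed.

Lemma ix_ltS x y : (ix y < (ix x).+1) = (y == x) || (ix y < ix x).
Proof. by rewrite ltnS leq_eqVlt ix_eq. Qed.

Lemma ix_surj i : i < size vs -> exists x, ix x = i.
Proof.
have vs_uniq : uniq vs by rewrite (perm_uniq pres.1) enum_uniq.
case: (vs) vs_uniq => // x0 s s_uniq lt; exists (nth x0 (x0 :: s) i).
exact: index_uniq.
Qed.

Lemma count_nb (P : pred G) x : count P (nb x) = #|[set y in nbrs x | P y]|.
Proof.
rewrite (permP (pres.2 x)) -size_filter cardE; apply: perm_size.
apply: uniq_perm => [||y]; [exact/filter_uniq/enum_uniq | exact: enum_uniq |].
by rewrite mem_filter !mem_enum !inE andbC.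
Qed.

Lemma mem_nb x y : (y \in nb x) = adj x y.
Proof. by rewrite (perm_mem (pres.2 x)) mem_enum inE. Qed.

Lemma size_nb x : size (nb x) = #|nbrs x|.
Proof. by rewrite (perm_size (pres.2 x)) cardE. Qed.

Lemma size_nb_le x : size (nb x) <= d.
Proof. by rewrite size_nb; apply: leq_trans (leq_bigmax x) Gd. Qed.

Definition input m : Prop :=
  [/\ reg m 0 = size vs, reg m 9 = 0 & forall x,
      arr m 0 (ix x).+1 = arr m 0 (ix x) + size (nb x) /\
      forall k, k < size (nb x) -> arr m 1 (arr m 0 (ix x) + k) = ix (nth x (nb x) k)].

Definition coded m (a : nat) g : Prop := forall x, arr m a (ix x) = g x.

Lemma input_input_memory : input (input_memory vs nb).
Proof.
split=> // x; have xv := ix_lt x; rewrite /= xv (ltnW xv).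
set lists := [seq _ | _ <- _].
have listx : nth [::] lists (ix x) = [seq ix y | y <- nb x].
  by rewrite (nth_map x) ?nth_index ?mem_vs.
split=> [|k kx]; last first.
  by rewrite nth_flatten_shape listx ?size_map // (nth_map x).
rewrite (take_nth 0) ?size_map // -cats1 sumn_cat /= addn0.
by rewrite (nth_map [::]) ?size_map // listx size_map.
Qed.

Lemma input_frame (p : cmd) m m' :
  [&& 0 \notin wregs p, 9 \notin wregs p, 0 \notin warrs p & 1 \notin warrs p] ->
  frame p m m' -> input m -> input m'.
Proof.
case/and4P => r0 r9 a0 a1 [fr fa] [i0 i9 inx].
by split; rewrite ?fr // => x; rewrite !fa.
Qed.

(** The frame condition offered to the body spares the invariant [Inv] all that the
    loop leaves untouched. *)
Lemma runs_each_vertex body m0 B (Inv : nat -> memory -> Prop)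
    (W := each_vertex body) :
  0 \notin wregs body -> 1 \notin wregs body -> reg m0 0 = size vs ->
  (forall i m v, Inv i m -> Inv i (set_reg m 1 v)) ->
  (forall x m, frame W m0 m -> reg m 1 = ix x -> Inv (ix x) m ->
     runs body m B (Inv (ix x).+1)) ->
  Inv 0 m0 ->
  runs W m0 (size vs * B.+3).+3 (fun m' => Inv (size vs) m' /\ frame W m0 m').
Proof.
move=> b0 b1 m0n Iset Ibody I0.
pose I i m := [/\ reg m 1 = i, reg m 0 = size vs, Inv i m & frame W m0 m].
have W1 : 1 \in wregs W by rewrite inE.
apply: (@runs_weaken _ _ (1 + ((size vs - 0) * B.+3).+1).+1 _ (I (size vs))).
- apply: runs_seq; first by apply: runs_straight => //; exact: erefl.
  move=> _ <-; apply: (runs_for (I := I)) => //.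
  + by move=> i m [].
  + move=> i m lt [m1 mn Im fm]; have [x xi] := ix_surj lt.
    rewrite -{}xi in m1 Im *.
    apply: (@runs_weaken _ _ (B + 1).+1 _ (I (ix x).+1)) => //; last by rewrite addn1.
    apply: runs_seq (runs_frame (Ibody x m fm m1 Im)) _ => m2 [Im2 [fr fa]].
    apply: runs_straight => //; split=> /=.
    * by rewrite /upd /= fr // m1.
    * by rewrite /upd /= fr.
    * exact: Iset.
    * apply: frame_trans (frame_set_reg _ _ W1).
      apply: frame_trans fm _; apply: frame_sub (conj fr fa) => z zb.
        by rewrite inE /= mem_cat zb orbT.
      by rewrite /W /= cats0.
  + by split=> //; [apply: Iset | apply: frame_set_reg].
- by rewrite subn0; lia.
- by move=> m [].
Qed.

Lemma runs_scan a g x m : input m -> reg m 1 = ix x -> coded m a g ->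
  runs (scan a) m (13 + 10 * d)
    (fun m' => [/\ reg m' 7 = count (fun y => g y == reg m 4) (nb x),
                   reg m' 8 = count (fun y => g y != reg m 4) (nb x) &
                   frame (scan a) m m']).
Proof.
move=> [m0 m9 /(_ x)[off nbx]] m1 ag; pose lo := arr m 0 (ix x).
pose hits i P := count (fun y => P (g y == reg m 4)) (take (i - lo) (nb x)).
pose I i m' := [/\ lo <= i, reg m' 2 = i /\ reg m' 3 = lo + size (nb x),
  reg m' 4 = reg m 4, arr m' = arr m &
  reg m' 7 = hits i id /\ reg m' 8 = hits i negb].
suff : runs (scan a) m (13 + 10 * d) (I (lo + size (nb x))).
  move/runs_frame/runs_weaken; apply=> // m' [[_ _ _ _ [-> ->]] fm].
  by rewrite /hits addKn take_size.
apply: (@runs_weaken _ _ (11 + (((lo + size (nb x)) - lo) * 10).+1).+1 _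
  (I (lo + size (nb x)))) => //; last by have := size_nb_le x; lia.
apply: runs_seq; first by apply: runs_straight => //; exact: erefl.
move=> _ <-; apply: (runs_for (I := I)); last 2 first.
- by rewrite leq_addr.
- by rewrite /I /hits /= /upd /= m1 off subnn take0.
- by move=> i m' [].
move=> i m' lt [lo_i [m2 m3] m4 marr [m7 m8]].
have lt_k : i - lo < size (nb x) by lia.
have nb_i : arr m 1 i = ix (nth x (nb x) (i - lo)) by rewrite -nbx // subnKC.
have hitsS P : hits i.+1 P = hits i P + P (g (nth x (nb x) (i - lo)) == reg m 4).
  by rewrite /hits subSn // (take_nth x) // -cats1 count_cat /= addn0.
have ltS : lo <= i.+1 by apply: leqW.
apply: runs_straight => //; rewrite /I !hitsS /= marr m2 /upd /= nb_i ag m4 -m7 -m8.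
by case: eqP => _ /=; rewrite /upd /= m2 ?addn1 ?addn0.
Qed.

Lemma unhappy_count e c x :
  unhappy e c x =
    if e then count (fun y => (c y : nat) != c x) (nb x)
              < count (fun y => (c y : nat) == c x) (nb x)
    else count (fun y => (c y : nat) == c x) (nb x)
         < count (fun y => (c y : nat) != c x) (nb x).
Proof.
have eqb (a b : bool) : ((a : nat) == b) = (a == b) by case: a b => [] [].
have -> : count (fun y => (c y : nat) == c x) (nb x) = count (fun y => c y == c x) (nb x).
  by apply: eq_count => y; rewrite eqb.
have -> : count (fun y => (c y : nat) != c x) (nb x) = count (predC (fun y => c y == c x)) (nb x).
  by apply: eq_count => y; rewrite eqb.
have := count_predC (fun y => c y == c x) (nb x).
rewrite /unhappy -ltnNge -size_nb -(count_nb (agree e c x)) => <-.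
rewrite /agree; case: e => /=; last by lia.
rewrite (eq_count (a2 := predC (fun y => c y == c x))) //; lia.
Qed.

Lemma eval_unhappy_test e c x m :
  reg m 7 = count (fun y => (c y : nat) == c x) (nb x) ->
  reg m 8 = count (fun y => (c y : nat) != c x) (nb x) ->
  eval_test m (unhappy_test e) = unhappy e c x.
Proof. by move=> m7 m8; rewrite unhappy_count; case: e; rewrite /= m7 m8. Qed.

(** Treating the vertices one after the other is the same as treating them
    simultaneously, because the neighbours of a treated vertex bear other
    labels. *)
Lemma runs_update e lab l c m :
  proper lab -> input m -> coded m 3 lab -> coded m 4 c ->
  runs (each_vertex (update_vertex e l)) m (size vs * (32 + 10 * d) + 3)
    (fun m' => coded m' 4 (update e lab l c) /\
               frame (each_vertex (update_vertex e l)) m m').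
Proof.
move=> plab mi m3 m4.
pose mix i x : bool := if ix x < i then update e lab l c x else c x.
pose Inv i m' := coded m' 4 (mix i).
apply: (@runs_weaken _ _ (size vs * (29 + 10 * d).+3).+3 _ (fun m' => Inv (size vs) m' /\ _)).
- apply: runs_each_vertex => //; first by case: mi.
  + move=> x m1 fm m11 m14.
    have m1i : input m1 by exact: input_frame fm mi.
    have m13 : coded m1 3 lab by move=> y; rewrite fm.2.
    apply: (@runs_weaken _ _ (1 + (13 + 10 * d + 13).+1).+1 _ (Inv (ix x).+1)) => //; last by lia.
    apply: runs_seq; first by apply: runs_straight => //; exact: erefl.
    move=> _ <-; set m2 := exec _ m1.
    have m24 : reg m2 4 = c x by rewrite /= m11 /upd /= m14 /mix ltnn.
    apply: runs_seq (runs_scan (g := mix (ix x)) (x := x) (m := m2) m1i m11 m14) _.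
    move=> m' [m'7 m'8 [fr fa]].
    have m'1 : reg m' 1 = ix x by rewrite fr.
    have m'4 : reg m' 4 = c x by rewrite fr.
    have m'9 : reg m' 9 = 0 by rewrite fr //; case: m1i.
    have m'a : arr m' 4 = arr m1 4 by rewrite fa.
    have m'l : arr m' 3 (ix x) = lab x by rewrite fa // m13.
    have other y : y != x -> mix (ix x).+1 y = mix (ix x) y.
      by move=> yx; rewrite /mix ix_ltS (negbTE yx).
    have this : mix (ix x).+1 x = update e lab l c x by rewrite /mix ltnSn.
    have kept : update e lab l c x = c x -> Inv (ix x).+1 m'.
      move=> ux y; rewrite m'a m14; case: (eqVneq y x) => [->|/other -> //].
      by rewrite this ux /mix ltnn.
    case: (eqVneq (lab x) l) => xl; last first.
      have ux : update e lab l c x = c x by rewrite /update inE (negbTE xl).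
      apply: runs_straight => //=; case: ifP => _; last exact: kept.
      by rewrite /upd /= m'1 m'l (negbTE xl); apply: kept.
    have test : eval_test m' (unhappy_test e) = unhappy e c x.
      have old y : y \in nb x -> mix (ix x) y = c y.
        rewrite mem_nb => /plab /negbTE xy.
        by rewrite /mix /update inE -xl eq_sym xy if_same.
      apply: eval_unhappy_test; rewrite ?m'7 ?m'8 m24;
        by apply: eq_in_count => y /old ->.
    apply: runs_straight => //=; rewrite test; case: ifP => ux; last first.
      by apply: kept; rewrite /update inE ux andbF.
    have flipped : update e lab l c x = ~~ c x by rewrite /update inE xl eqxx ux.
    move=> y; rewrite /= /upd /= m'1 m'l xl eqxx /= m'4 m'9.
    have unflipped : y != x -> arr m' 4 (ix y) = mix (ix x).+1 y.
      by move=> yx; rewrite m'a other // m14.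
    case cx: (c x) flipped => /= flipped; rewrite /upd /= m'1 ix_eq;
      by case: (eqVneq y x) => [->|//]; rewrite this flipped.
- by lia.
- by move=> m' [m'4 fm']; split=> // x; rewrite m'4 /mix ix_lt.
Qed.

(** Label 0 means unlabelled; the labels below [l] have been offered to all
    vertices, and [l] to the first [i]. A vertex still unlabelled has refused each
    label offered because of a neighbour bearing it. *)
Definition partial_labelling (l i : nat) m : Prop :=
  exists lab, [/\ coded m 3 lab, forall x, lab x <= l,
    forall x y, adj x y -> lab x = lab y -> lab x = 0 &
    forall x k, lab x = 0 -> 0 < k -> k < l \/ (k = l /\ ix x < i) ->
      exists2 y, adj x y & lab y = k].

Lemma runs_label l m : 0 < l -> input m -> partial_labelling l 0 m ->
  runs (each_vertex (label_vertex l)) m (size vs * (28 + 10 * d) + 3)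
    (fun m' => partial_labelling l (size vs) m' /\
               frame (each_vertex (label_vertex l)) m m').
Proof.
move=> l0 mi m0.
apply: (@runs_weaken _ _ (size vs * (25 + 10 * d).+3).+3 _
  (fun m' => partial_labelling l (size vs) m' /\
     frame (each_vertex (label_vertex l)) m m')) => [||//]; last by lia.
- apply: (runs_each_vertex (Inv := partial_labelling l)) => //; first by case: mi.
  move=> x m1 fm m11 [lab [m13 labl labp labk]].
  have m1i : input m1 by exact: input_frame fm mi.
  apply: (@runs_weaken _ _ (1 + (13 + 10 * d + 7).+1).+1 _
    (partial_labelling l (ix x).+1)) => //; last by lia.
  apply: runs_seq; first by apply: runs_straight => //; exact: erefl.
  move=> _ <-; set m2 := exec _ m1.
  apply: runs_seq (runs_scan (g := lab) (x := x) (m := m2) m1i m11 m13) _.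
  move=> m' [m'7 _ [fr fa]].
  have m'1 : reg m' 1 = ix x by rewrite fr.
  have m'4 : reg m' 4 = l by rewrite fr.
  have m'9 : reg m' 9 = 0 by rewrite fr //; case: m1i.
  have m'3 : arr m' 3 = arr m1 3 by rewrite fa.
  have m'x : arr m' 3 (ix x) = lab x by rewrite m'3 m13.
  have kept : (lab x = 0 -> exists2 y, adj x y & lab y = l) ->
      partial_labelling l (ix x).+1 m'.
    move=> xl; exists lab; split=> // [y|y k y0 k0]; first by rewrite m'3 m13.
    case=> [kl|[kl]]; first by apply: labk => //; left.
    rewrite ix_ltS => /predU1P[yx|yx]; first by rewrite yx kl; apply: xl; rewrite -yx.
    by apply: labk => //; right.
  apply: runs_straight => //=; rewrite /upd /= m'1 m'x m'9.
  case: eqP => [x0|x0]; last exact: kept.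
  rewrite m'7; case: eqP => [/eqP|/eqP]; last first.
    rewrite -lt0n -has_count => /hasP[y]; rewrite mem_nb => xy /eqP yl.
    by apply: kept => _; exists y.
  rewrite -leqn0 leqNgt -has_count => /hasPn nol.
  have fresh y : adj x y -> lab y != l by rewrite -mem_nb; apply: nol.
  exists (fun y => if y == x then l else lab y); split.
  + by move=> y; rewrite /= /upd /= ?m'1 m'4 ix_eq; case: eqP => // _; rewrite m'3 m13.
  + by move=> y; case: eqP.
  + move=> y z yz; case: (eqVneq y x) yz => [->|yx]; case: (eqVneq z x) => [->|zx].
    * by rewrite adj_irrefl.
    * by move=> /fresh /eqP zl lz; case: zl.
    * by rewrite adj_sym => /fresh /eqP.
    * exact: labp.
  + move=> y k; case: (eqVneq y x) => [_ l_0|yx]; first by rewrite l_0 in l0.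
    move=> y0 k0 kl; have [|z yz zk] := labk y k y0 k0.
      case: kl => [|[kl]]; first by left.
      by rewrite ix_ltS (negbTE yx); right.
    exists z => //; case: eqP => // zx.
    by move: k0; rewrite -zk zx x0.
Qed.

Lemma next_label l m :
  partial_labelling l (size vs) m -> partial_labelling l.+1 0 m.
Proof.
case=> lab [m3 labl labp labk]; exists lab; split=> // [x|x k x0 k0].
  by rewrite leqW.
case=> [|[]//]; rewrite ltnS leq_eqVlt => /predU1P[kl|kl]; apply: labk => //.
  by right; rewrite ix_lt.
by left.
Qed.

(** A vertex left without label would see all [d.+1] labels around it. *)
Lemma labelling_proper m : partial_labelling d.+1 (size vs) m ->
  exists lab, [/\ coded m 3 lab, proper lab & forall x, lab x \in iota 1 d.+1].
Proof.
case=> lab [m3 labl labp labk].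
have lab0 x : lab x != 0.
  apply/eqP => x0.
  suff : d.+1 <= #|nbrs x| by rewrite leqNgt ltnS -size_nb size_nb_le.
  rewrite -[d.+1](size_iota 1) -size_nb -(size_map lab).
  apply: uniq_leq_size; first exact: iota_uniq.
  move=> k; rewrite mem_iota add1n ltnS => /andP[k0]; rewrite leq_eqVlt => kd.
  have [|y xy <-] := labk x k x0 k0.
    by case/predU1P: kd => [->|]; [right; rewrite ix_lt | left].
  by apply: map_f; rewrite mem_nb.
exists lab; split=> // [x y xy|x].
  by apply/eqP => xyl; have := lab0 x; rewrite (labp x y) ?eqxx.
by rewrite mem_iota add1n ltnS labl lt0n lab0.
Qed.

Lemma card_prefix (P : pred G) x :
  #|[set y | (ix y < (ix x).+1) && P y]| = P x + #|[set y | (ix y < ix x) && P y]|.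
Proof.
rewrite (cardsD1 x) !inE leqnn /=; congr (_ + _); apply: eq_card => y.
rewrite !inE ix_ltS; case: (eqVneq y x) => [->|_] //=.
by rewrite ltnn.
Qed.

Lemma card_prefix0 (P : pred G) : #|[set y | (ix y < 0) && P y]| = 0.
Proof. by apply: eq_card0 => y; rewrite !inE ltn0. Qed.

Lemma card_prefixT (P : pred G) :
  #|[set y | (ix y < size vs) && P y]| = #|[set y | P y]|.
Proof. by apply: eq_card => y; rewrite !inE ix_lt. Qed.

Lemma runs_tally c m : input m -> coded m 4 c ->
  runs tally m (size vs * 9 + 7)
    (fun m' => [/\ reg m' 11 = red c, reg m' 12 = red (fun x => ~~ c x) &
                   frame tally m m']).
Proof.
move=> mi m4; pose cnt i (P : pred G) := #|[set y | (ix y < i) && P y]|.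
pose Inv i m' := reg m' 11 = cnt i c /\ reg m' 12 = cnt i (fun x => ~~ c x).
have : runs tally m (size vs * 9 + 7) (Inv (size vs)).
  pose m0 := exec (Const 11 0 ;; Const 12 0) m.
  pose p := each_vertex (Get 4 4 1 ;; If (TestEq 4 9) (Inc 12) (Inc 11)).
  apply: (@runs_weaken _ _ (3 + (size vs * 5.+3).+3).+1 _
    (fun m' => Inv (size vs) m' /\ frame p m0 m')) => [||m' []//]; last by lia.
  apply: runs_seq; first by apply: runs_straight => //; exact: erefl.
  move=> _ <-; apply: runs_each_vertex => //; first by case: mi.
    move=> x m1 [fr fa] m11 [i11 i12].
    have m19 : reg m1 9 = 0 by rewrite fr //; case: mi.
    have m1x : arr m1 4 (ix x) = c x by rewrite fa // -m4.
    apply: runs_straight => //; rewrite /= /upd /= m11 m1x m19 /Inv /cnt !card_prefix.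
    by case: (c x) => /=; rewrite /upd /= i11 i12.
  by rewrite /Inv /cnt !card_prefix0.
move/runs_frame/runs_weaken; apply=> // m' [[-> ->] fm].
by rewrite /cnt !card_prefixT.
Qed.

Lemma red_recolour c x (b : bool) :
  red (fun y => if y == x then b else c y) + c x = red c + b.
Proof.
rewrite /red (cardsD1 x) [in RHS](cardsD1 x) !inE eqxx.
rewrite (_ : [set y | _] :\ x = [set y | c y] :\ x); first by lia.
by apply/setP => y; rewrite !inE; case: eqP.
Qed.

Lemma red_blue c : red c + red (fun y => ~~ c y) = #|G|.
Proof.
rewrite /red -(cardsC [set y | c y]); congr (_ + _).
by apply: eq_card => y; rewrite !inE.
Qed.

(** Each recolouring of a vertex of the majority colour brings the two counts
    closer by two; vertices are recoloured in order until the counts agree up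
    to one. *)
Lemma runs_balance c m : input m -> coded m 4 c ->
  reg m 11 = red c -> reg m 12 = red (fun x => ~~ c x) ->
  runs (each_vertex balance_vertex) m (size vs * 30 + 3)
    (fun m' => (exists h : G -> bool,
         [/\ coded m' 2 h, bisection h & 2 * #|differ c h| <= imbalance c]) /\
       frame (each_vertex balance_vertex) m m').
Proof.
move=> mi m4 m_r m_b.
pose Inv i m' := exists h : G -> bool,
  [/\ forall x, ix x < i -> arr m' 2 (ix x) = h x,
      forall x, i <= ix x -> h x = c x,
      reg m' 11 = red h /\ reg m' 12 = red (fun x => ~~ h x),
      2 * #|differ c h| + imbalance h <= imbalance c &
      ((red (fun x => ~~ h x)).+1 < red h -> forall x, ix x < i -> ~~ h x) /\
      ((red h).+1 < red (fun x => ~~ h x) -> forall x, ix x < i -> h x)].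
apply: (@runs_weaken _ _ (size vs * 27.+3).+3 _ (fun m' => Inv (size vs) m' /\ _)).
- apply: runs_each_vertex => //; first by case: mi.
    move=> x m1 [fr fa] m11 [h [m12 hc [r11 r12] dh [hr hb]]].
    have m19 : reg m1 9 = 0 by rewrite fr //; case: mi.
    have m14 : arr m1 4 (ix x) = c x by rewrite fa // m4.
    have hx : h x = c x by apply: hc.
    have next (h' : G -> bool) m' : (forall y, y != x -> h' y = h y) ->
        arr m' 2 (ix x) = h' x ->
        (forall y, y != x -> arr m' 2 (ix y) = arr m1 2 (ix y)) ->
        reg m' 11 = red h' -> reg m' 12 = red (fun y => ~~ h' y) ->
        2 * #|differ c h'| + imbalance h' <= imbalance c ->
        ((red (fun y => ~~ h' y)).+1 < red h' ->
           ~~ h' x /\ (red (fun y => ~~ h y)).+1 < red h) ->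
        ((red h').+1 < red (fun y => ~~ h' y) ->
           h' x /\ (red h).+1 < red (fun y => ~~ h y)) ->
        Inv (ix x).+1 m'.
      move=> h'h m'x m'2 m'11 m'12 dh' hr' hb'; exists h'; split=> //.
      - move=> y; rewrite ix_ltS; case: (eqVneq y x) => [->//|yx] /= yi.
        by rewrite m'2 // m12 // h'h.
      - move=> y xy; have yx : y != x.
          by apply: contraTneq xy => ->; rewrite -ltnNge.
        by rewrite h'h // hc // ltnW.
      - split=> [/hr'|/hb'] [h'x ineq] y; rewrite ix_ltS;
          case: (eqVneq y x) => [->//|yx] /= yi; rewrite h'h //.
          exact: hr.
        exact: hb.
    have recolour (b : bool) (h' := fun y => if y == x then b else h y) m' :
        h x = ~~ b ->
        (if b then (red h).+1 < red (fun y => ~~ h y)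
         else (red (fun y => ~~ h y)).+1 < red h) ->
        arr m' 2 (ix x) = b ->
        (forall y, y != x -> arr m' 2 (ix y) = arr m1 2 (ix y)) ->
        reg m' 11 = (if b then (red h).+1 else (red h).-1) ->
        reg m' 12 = (if b then (red (fun y => ~~ h y)).-1
                     else (red (fun y => ~~ h y)).+1) ->
        Inv (ix x).+1 m'.
      move=> hxb ineq m'x m'2 m'11 m'12.
      have := red_recolour h x b; rewrite -/h' hxb => red_h'.
      have := red_blue h; have := red_blue h' => blue_h' blue_h.
      have h'x : h' x = b by rewrite /h' eqxx.
      have dh' : #|differ c h'| <= #|differ c h|.+1.
        apply: (@leq_trans #|x |: differ c h|).
          apply: subset_leq_card; apply/subsetP => y; rewrite /differ !inE /h'.
          by case: (eqVneq y x).
        by apply: leq_trans (leq_card_setU _ _) _; rewrite cards1.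
      apply: (next h') => //.
      - by move=> y /negbTE yx; rewrite /h' yx.
      - by rewrite h'x.
      - by rewrite m'11; case: (b) ineq red_h' => /=; lia.
      - by rewrite m'12; case: (b) ineq red_h' => /=; lia.
      - move: dh; rewrite /imbalance.
        by case: (b) ineq red_h' => /=; move: dh' blue_h blue_h'; lia.
      - by rewrite h'x; case: (b) ineq red_h' => /=; move: blue_h blue_h'; lia.
      - by rewrite h'x; case: (b) ineq red_h' => /=; move: blue_h blue_h'; lia.
    apply: runs_straight => //; rewrite /= /upd /= m11 m14 m19.
    case cx: (c x) hx => /= hx; rewrite /upd /= r11 r12; case: ltnP => ineq /=.
    + apply: (recolour false) => //=; rewrite /upd /= ?m11 ?eqxx ?r11 ?r12 // => y yx.
      by rewrite ix_eq (negbTE yx).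
    + apply: (next h) => //=; rewrite /upd /= ?m11 ?eqxx ?hx //; last by lia.
      by move=> y yx; rewrite ix_eq (negbTE yx).
    + apply: (recolour true) => //=; rewrite /upd /= ?m11 ?eqxx ?r11 ?r12 // => y yx.
      by rewrite ix_eq (negbTE yx).
    + apply: (next h) => //=; rewrite /upd /= ?m11 ?eqxx ?hx //; last by lia.
      by move=> y yx; rewrite ix_eq (negbTE yx).
  exists c; split=> //.
  by rewrite (_ : differ c c = set0) ?cards0 //; apply/setP => x; rewrite !inE eqxx.
- by lia.
- move=> m' [[h [m'2 _ _ dh [hr hb]]] fm']; split=> //; exists h; split=> //.
  + by move=> x; rewrite m'2 // ix_lt.
  + rewrite /bisection; have := red_blue h.
    have red0 (f : pred G) : (forall x, ~~ f x) -> red f = 0.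
      by move=> f0; apply: eq_card0 => x; rewrite !inE (negbTE (f0 x)).
    have hr' : red h <= (red (fun x => ~~ h x)).+1.
      rewrite leqNgt; apply/negP => lt.
      by move: (lt); rewrite (red0 h) // => x; apply: hr; rewrite ?ix_lt.
    have hb' : red (fun x => ~~ h x) <= (red h).+1.
      rewrite leqNgt; apply/negP => lt.
      move: (lt); rewrite (red0 (fun x => ~~ h x)) // => x.
      by rewrite negbK; apply: hb; rewrite ?ix_lt.
    move: hr' hb'; rewrite -/(red h) -/(red (fun x => ~~ h x)).
    by move: (red h) (red _) => r b; lia.
  + by lia.
Qed.

Lemma runs_check e a b c m : input m -> coded m 2 c ->
  runs (check e a b) m (size vs * (24 + 10 * d + 2 * a + 2 * b) + 11)
    (fun m' => reg m' 15 = (if a * #|G| < b * bad e c then reg m 15 else 1) /\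
               frame (check e a b) m m').
Proof.
move=> mi m2.
pose Inv i m' := reg m' 13 = a * i /\
  reg m' 14 = b * #|[set y | (ix y < i) && unhappy e c y]|.
pose Q m' := reg m' 15 = (if a * #|G| < b * bad e c then reg m 15 else 1).
suff : runs (check e a b) m (size vs * (24 + 10 * d + 2 * a + 2 * b) + 11) Q.
  by move/runs_frame.
pose m0 := exec (Const 13 0 ;; Const 14 0) m.
pose p := each_vertex (check_vertex e a b).
pose B := 21 + 10 * d + 2 * a + 2 * b.
apply: (@runs_weaken _ _ (3 + ((size vs * B.+3).+3 + 3).+1).+1 _
  Q) => [||//]; last by rewrite /B; lia.
apply: runs_seq; first by apply: runs_straight => //; exact: erefl.
move=> _ <-; apply: (runs_seq (Q1 := fun m' => Inv (size vs) m' /\ frame p m0 m')).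
  have incs_notin k (x y : nat) : x != y -> x \notin wregs (incs k y).
    by move=> xy; rewrite wregs_incs mem_nseq (negbTE xy) andbF.
  apply: runs_each_vertex => //.
  - by rewrite /= !(mem_cat, inE) !negb_or !incs_notin.
  - by rewrite /= !(mem_cat, inE) !negb_or !incs_notin.
  - by case: mi.
  - move=> x m1 fm m11 [i13 i14].
    have m1i : input m1.
      by apply: input_frame fm mi; rewrite /= !(mem_cat, inE) !negb_or !incs_notin //
        !warrs_incs.
    have m12 : coded m1 2 c.
      by move=> y; rewrite fm.2 //= !(mem_cat, inE) !warrs_incs.
    apply: (@runs_weaken _ _ (1 + (13 + 10 * d + (2 * a + 2 * b + 5)).+1).+1 _
      (Inv (ix x).+1)) => //; last by rewrite /B; lia.
    apply: runs_seq; first by apply: runs_straight => //; exact: erefl.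
    move=> _ <-; set m3 := exec _ m1.
    have m34 : reg m3 4 = c x by rewrite /= m11 /upd /= m12.
    apply: runs_seq (runs_scan (g := c) (x := x) (m := m3) m1i m11 m12) _.
    move=> m' [m'7 m'8 [fr fa]]; rewrite m34 in m'7 m'8.
    have m'13 : reg m' 13 = a * ix x by rewrite fr.
    have m'14 : reg m' 14 = b * #|[set y | (ix y < ix x) && unhappy e c y]|.
      by rewrite fr.
    have -> : 2 * a + 2 * b + 5 =
        len (incs a 13 ;; If (unhappy_test e) (incs b 14) Skip).
      by rewrite /= !len_incs; lia.
    apply: runs_straight; rewrite /= ?straight_incs //.
    rewrite (@eval_unhappy_test _ c x) ?reg_incs /= ?addn0 //.
    rewrite /Inv card_prefix mulnDr mulnS.
    by case: (unhappy e c x); rewrite /= !reg_incs /= m'13 m'14; split; lia.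
  - by rewrite /Inv card_prefix0 !muln0.
move=> m1 [[m1_13 m1_14] fm]; apply: runs_straight => //=.
rewrite /Q m1_13 m1_14 card_prefixT -/(bad e c) size_vs; case: ifP => _ //.
by rewrite fm.1 //= !(mem_cat, inE) !negb_or !wregs_incs !mem_nseq !andbF.
Qed.

End Passes.
(** * The algorithm *)

Definition seqs (F : nat -> cmd) (ls : seq nat) : cmd :=
  foldr (fun l p => F l ;; p) Skip ls.

Lemma runs_seqs F ls m B (I : seq nat -> memory -> Prop) :
  (forall l ls' m', I (l :: ls') m' -> runs (F l) m' B (I ls')) -> I ls m ->
  runs (seqs F ls) m (size ls * B.+1 + 1) (I [::]).
Proof.
move=> IF; elim: ls m => [|l ls IH] m Im; first exact: runs_straight.
apply: (runs_weaken (Q := I [::])) (runs_seq (IF _ _ _ Im) IH) _ _ => //.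
by rewrite /=; lia.
Qed.

Definition labels (d : nat) : seq nat := iota 1 d.+1.

Definition label_all (d : nat) : cmd :=
  seqs (fun l => each_vertex (label_vertex l)) (labels d).

Definition round (e : bool) (d : nat) : cmd :=
  seqs (fun l => each_vertex (update_vertex e l)) (labels d).

Definition stage (e : bool) (a b d : nat) : cmd :=
  If (TestEq 15 9)
    (tally ;; each_vertex balance_vertex ;; check e a b ;; round e d) Skip.

Definition stages (e : bool) (a b d T : nat) : cmd :=
  seqs (fun=> stage e a b d) (iota 0 T.+1).

Definition algorithm (e : bool) (a b d T : nat) : cmd :=
  label_all d ;; While (TestEq 15 9) (fill 4 ;; stages e a b d T).

Definition label_time (d n : nat) : nat := d.+1 * (n * (28 + 10 * d) + 3).+1 + 1.

Definition round_time (d n : nat) : nat := d.+1 * (n * (32 + 10 * d) + 3).+1 + 1.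

Definition stage_time (a b d n : nat) : nat :=
  (n * 9 + 7) + (n * 30 + 3) + (n * (24 + 10 * d + 2 * a + 2 * b) + 11) +
  round_time d n + 4.

Definition stages_time (a b d T n : nat) : nat := T.+1 * (stage_time a b d n).+1 + 1.

Definition algorithm_time (a b d T P n : nat) : nat :=
  1 + label_time d n + P * (6 * n + stages_time a b d T n + 6).

Definition acceptable (G : sgraph) (e : bool) (a b : nat) (c : G -> bool) : Prop :=
  bisection c /\ b * bad e c <= a * #|G|.

Section Algorithm.

Variables (G : sgraph) (vs : seq G) (nb : G -> seq G) (d : nat).
Hypothesis pres : presentation vs nb.
Hypothesis Gd : max_degree G <= d.
Variables (e : bool) (a b : nat).
Implicit Types (m : memory) (x y : G) (lab : G -> nat) (c h : G -> bool).

Notation ix x := (index x vs).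
Notation input := (input vs nb).
Notation coded := (coded vs).
Notation n := (size vs).

Definition labelling lab : Prop := proper lab /\ forall x, lab x \in labels d.

Lemma runs_label_all m : input m -> coded m 3 (fun=> 0) -> reg m 15 = 0 ->
  runs (label_all d) m (label_time d n)
    (fun m' => [/\ input m', reg m' 15 = 0 &
       exists2 lab, coded m' 3 lab & labelling lab]).
Proof.
move=> mi m3 m15.
pose I ls m' := [/\ input m', reg m' 15 = 0 & exists l,
  [/\ ls = iota l.+1 (d.+1 - l), l <= d.+1 & partial_labelling vs l n m']].
have : runs (label_all d) m (label_time d n) (I [::]).
  rewrite /label_time -{1}(size_iota 1 d.+1); apply: runs_seqs.
    move=> l ls m' [m'i m'15 [k [lsE kd mk]]].
    case E: (d.+1 - k) lsE => [//|r] /= [-> lsE].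
    have := runs_label pres Gd (ltn0Sn k) m'i (next_label pres mk).
    move/runs_weaken; apply=> // m'' [m''l fm].
    split; first exact: input_frame fm m'i.
      by rewrite fm.1.
    exists k.+1; split=> //; last by lia.
    by rewrite lsE (_ : d.+1 - k.+1 = r) //; lia.
  split=> //; exists 0; split=> //; exists (fun=> 0); split=> // x k _ k0.
  by case=> [|[kE]] //; rewrite kE in k0.
move/runs_weaken; apply=> // m' [m'i m'15 [k [kE kd mk]]]; split=> //.
have kd' : k = d.+1 by case E: (d.+1 - k) kE => [|//] _; lia.
rewrite kd' in mk; have [lab [m'3 ? ?]] := labelling_proper pres Gd mk.
by exists lab.
Qed.

Lemma runs_round lab c m : proper lab ->
  input m -> coded m 3 lab -> coded m 4 c ->
  runs (round e d) m (round_time d n)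
    (fun m' => [/\ input m', coded m' 3 lab, reg m' 15 = reg m 15,
       arr m' 2 = arr m 2 & coded m' 4 (sweep e lab (labels d) c)]).
Proof.
move=> plab mi m3 m4.
pose I ls m' := [/\ input m', coded m' 3 lab, reg m' 15 = reg m 15,
  arr m' 2 = arr m 2 & exists2 c' : G -> bool, coded m' 4 c' &
  sweep e lab ls c' = sweep e lab (labels d) c].
have : runs (round e d) m (round_time d n) (I [::]).
  rewrite /round_time -{1}(size_iota 1 d.+1); apply: runs_seqs; last first.
    by split=> //; exists c.
  move=> l ls m' [m'i m'3 m'15 m'2 [c' m'4 c'E]].
  have := runs_update pres Gd e l plab m'i m'3 m'4.
  move/runs_weaken; apply=> // m'' [m''4 fm]; split.
  - exact: input_frame fm m'i.
  - by move=> x; rewrite fm.2.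
  - by rewrite fm.1.
  - by rewrite fm.2.
  - by exists (update e lab l c').
move/runs_weaken; apply=> // m' [? ? ? ? [c' m'4 <-]]; split=> //.
Qed.

Definition solved m : Prop := exists2 h : G -> bool, coded m 2 h & acceptable e a b h.

(** The state of an attempt that started from the seed [s] after [j] rounds; once
    the flag in register 15 is up nothing changes any more. *)
Definition progress lab (s : G -> bool) (j : nat) m : Prop :=
  [/\ input m, coded m 3 lab, reg m 15 = 0 -> coded m 4 (sweep e lab (rounds j (labels d)) s),
      reg m 15 != 0 -> solved m &
      forall i, i < j -> rebalances_well e a b (sweep e lab (rounds i (labels d)) s) ->
        reg m 15 != 0].

Lemma runs_stage lab s j m : proper lab -> progress lab s j m ->
  runs (stage e a b d) m (stage_time a b d n) (progress lab s j.+1).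
Proof.
move=> plab [mi m3 m4 m_ok m_done]; have [_ m9 _] := mi.
set c := sweep _ _ _ _ in m4.
case: (eqVneq (reg m 15) 0) => m15; last first.
  apply: (@runs_weaken _ _ 2 _ (progress lab s j.+1)) => //; last by rewrite /stage_time; lia.
  apply: runs_if; rewrite /= m9 (negbTE m15); apply: runs_straight => //=.
  by split=> // m15'; rewrite m15' in m15.
have {}m4 := m4 m15.
pose t1 := n * 9 + 7; pose t2 := n * 30 + 3.
pose t3 := n * (24 + 10 * d + 2 * a + 2 * b) + 11; pose t4 := round_time d n.
apply: (@runs_weaken _ _ (t1 + (t2 + (t3 + t4).+1).+1).+2 _ (progress lab s j.+1)) => //;
  last by rewrite /stage_time /t1 /t2 /t3 /t4; lia.
apply: runs_if; rewrite /= m9 m15 /=.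
apply: runs_seq (runs_tally pres Gd mi m4) _ => m1 [m1_r m1_b fm1].
have m1i : input m1 by exact: input_frame fm1 mi.
have m14 : coded m1 4 c by move=> x; rewrite fm1.2.
apply: runs_seq (runs_balance pres Gd m1i m14 m1_r m1_b) _ => m2 [[h [m22 bis_h dh]] fm2].
have m2i : input m2 by exact: input_frame fm2 m1i.
apply: runs_seq (runs_check pres Gd e a b m2i m22) _ => m3' [m3_15 fm3].
have notin (z x : nat) k : z != x -> z \notin wregs (incs k x).
  by move=> zx; rewrite wregs_incs mem_nseq (negbTE zx) andbF.
have m3i : input m3'.
  by apply: input_frame fm3 m2i; rewrite /= !(mem_cat, inE) !negb_or !notin // !warrs_incs.
have m3_arr k : arr m3' k = arr m2 k.
  by rewrite fm3.2 //= !(mem_cat, inE) !warrs_incs.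
have m33 : coded m3' 3 lab by move=> x; rewrite m3_arr fm2.2 // fm1.2.
have m34 : coded m3' 4 c by move=> x; rewrite m3_arr fm2.2.
move: (runs_round plab m3i m33 m34) => /runs_weaken; apply=> // m' [m'i m'3 m'15 m'2 m'4].
have m2_15 : reg m2 15 = 0 by rewrite fm2.1 // fm1.1.
split=> //.
- by rewrite roundsS sweep_cat.
- rewrite m'15 m3_15 m2_15; case: ltnP => // acc _.
  by exists h => //; move=> x; rewrite m'2 m3_arr.
- move=> i; rewrite ltnS leq_eqVlt => /predU1P[->|/m_done H /H]; last by rewrite m15.
  by move=> /(_ h dh); rewrite -/c m'15 m3_15; case: ltnP => //; lia.
Qed.

Lemma runs_stages T lab s m : proper lab -> progress lab s 0 m ->
  runs (stages e a b d T) m (stages_time a b d T n) (progress lab s T.+1).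
Proof.
move=> plab m0.
pose I ls m' := exists j,
  [/\ ls = iota j (T.+1 - j), j <= T.+1 & progress lab s j m'].
have : runs (stages e a b d T) m (stages_time a b d T n) (I [::]).
  rewrite /stages_time -[X in X * _](size_iota 0 T.+1); apply: runs_seqs; last by exists 0.
  move=> l ls m' [j [lsE jT m'j]].
  case E: (T.+1 - j) lsE => [//|r] /= [_ lsE].
  move: (runs_stage plab m'j) => /runs_weaken; apply=> // m'' m''j.
  exists j.+1; split=> //; last by lia.
  by rewrite lsE (_ : T.+1 - j.+1 = r) //; lia.
move/runs_weaken; apply=> // m' [j [jE jT]].
by have -> : j = T.+1 by case E: (T.+1 - j) jE => [|//] _; lia.
Qed.

Definition seed_of (w : seq bool) : {ffun G -> bool} := [ffun x => nth false w (ix x)].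

Lemma avg_seeds (R : realType) (A : {set {ffun G -> bool}}) (P : nat) :
  2 ^ #|G| <= P * #|A| ->
  (1 <= P%:R * avg n (fun w => (seed_of w \in A)%:R) :> R)%R.
Proof.
rewrite avgE => PA.
have -> : (\sum_(w : n.-tuple bool) (seed_of w \in A)%:R = #|A|%:R :> R)%R.
  rewrite -sum1_card natr_sum [RHS]big_mkcond /=.
  rewrite [RHS](reindex (fun w : n.-tuple bool => seed_of w)) /=.
    by apply: eq_bigr => w _; case: (_ \in A).
  exists (fun s : {ffun G -> bool} => map_tuple s (in_tuple vs)) => [w _|s _].
    apply: val_inj; apply: (@eq_from_nth _ false); first by rewrite /= size_map size_tuple.
    rewrite /= size_map => i lt; have [x xi] := ix_surj pres lt.
    by rewrite (nth_map x) // ffunE -xi nth_index ?(mem_vs pres).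
  apply/ffunP => x; rewrite ffunE /= (nth_map x) ?nth_index ?(mem_vs pres) //.
  exact: ix_lt pres x.
rewrite mulrA ler_pdivlMr ?exprn_gt0 // mul1r -natrX -natrM ler_nat.
by rewrite (size_vs pres).
Qed.

Lemma algorithm_within (R : realType) T P t :
  (forall lab, labelling lab -> exists A : {set {ffun G -> bool}},
     2 ^ #|G| <= P * #|A| /\
     forall s, s \in A -> exists2 j, j <= T &
       rebalances_well e a b (sweep e lab (rounds j (labels d)) s)) ->
  within t (fun m => acceptable e a b (output_colouring vs m))
    ([:: algorithm e a b d T], input_memory vs nb)
    ((algorithm_time a b d T P n)%:R : R)%R.
Proof.
move=> seeds; set Q := fun m => _; set m0 := input_memory vs nb.
pose E : R := ((label_time d n)%:R + (P * (6 * n + stages_time a b d T n + 6))%:R)%R.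
have solvedQ m : solved m -> Q m.
  case=> h m2 h_ok; rewrite /Q (_ : output_colouring vs m = h) //.
  by apply/funext => x; rewrite /output_colouring m2 eqb0 negbK.
have wA : within t Q ([:: label_all d; While (TestEq 15 9) (fill 4 ;; stages e a b d T)], m0) E.
  apply: within_runs (runs_label_all _ _ _) _ => //; first exact: input_input_memory.
  move=> m [mi m15 [lab m3 lab_ok]].
  have [A [PA A_ok]] := seeds lab lab_ok.
  apply: (las_vegas (Inv := fun m => input m /\ coded m 3 lab)
    (avg_seeds R PA)) => //; first by move=> m' [[]].
  move=> m1 m' w [m1i m13] m1_15 szw val regs arrs.
  have m'i : input m'.
    by case: m1i => ? ? ?; split; rewrite ?regs // => x; rewrite !arrs.
  have m'0 : progress lab (seed_of w) 0 m'.
    split=> //.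
    - by move=> x; rewrite arrs.
    - by move=> _ x; rewrite val ?(ix_lt pres) //= ffunE.
    - by rewrite regs // m1_15.
  move: (runs_stages T lab_ok.1 m'0) => /runs_weaken; apply=> // m'' [? ? _ ok found].
  split=> // [/ok/solvedQ//|/A_ok[j jT]]; exact: found.
have := within_step (s := ([:: algorithm e a b d T], m0)) (t := t) (Q := Q)
  (B := fun=> E) isT (fun=> wA).
by apply: within_weaken; rewrite /E /algorithm_time !natrD /=; lra.
Qed.

End Algorithm.
(** * Large graphs and small graphs *)

Section Thresholds.

Variable R : realType.
Local Open Scope ring_scope.

(** The algorithm can only compare integers, so [eps] is replaced with a fraction
    [a / b <= eps]; this fraction must not lose anything for the finitely many
    small orders [n], but stay bounded below independently of their number. *)
Lemma rational_threshold (eps : R) : 0 < eps -> exists q : nat, forall N : nat,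
  exists a b : nat, [/\ (0 < b <= a * q.+1)%N, a%:R <= eps * b%:R &
    forall n k : nat, (n < N)%N -> k%:R <= eps * n%:R -> (b * k <= a * n)%N].
Proof.
move=> eps0; pose q := Num.trunc eps^-1; exists q.
have epsq : 1 <= eps * q.+1%:R.
  rewrite -ler_pdivrMl // mulr1 ltW // -truncn_le_nat //.
elim=> [|N [a [b [/andP[b0 ba] ab small]]]].
  by exists 1%N, q.+1; split=> //; rewrite mul1n leqnn.
pose k := Num.trunc (eps * N%:R).
have kP i : (i%:R <= eps * N%:R) = (i <= k)%N.
  by rewrite /k truncn_ge_nat // mulr_ge0 ?ler0n // ltW.
case: (leqP (b * k) (a * N)) => [kN|kN].
  exists a, b; split=> //; first by rewrite b0.
  move=> n i; rewrite ltnS leq_eqVlt => /predU1P[->|nN]; last exact: small.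
  by rewrite kP => ik; apply: leq_trans kN; rewrite leq_mul2l ik orbT.
have N0 : (0 < N)%N.
  rewrite lt0n; apply/negP => /eqP N0.
  by move: kN; rewrite /k N0 mulr0 truncn0 !muln0 ltnn.
exists k, N; split.
- rewrite N0 /=; have : (a * N < a * (k * q.+1))%N.
    by apply: leq_trans kN _; rewrite (mulnC k) mulnA leq_mul2r ba orbT.
  by move=> /ltnW; rewrite leq_mul2l => /orP[/eqP a0|//]; rewrite a0 in ba; lia.
- by rewrite kP.
- move=> n i; rewrite ltnS leq_eqVlt => /predU1P[->|nN].
    by rewrite kP => ik; rewrite mulnC leq_mul2r ik orbT.
  move=> /(small _ _ nN) bi; rewrite -(leq_pmul2l b0).
  apply: (@leq_trans (a * n * N)); first by nia.
  by rewrite mulnAC (leq_trans (leq_mul (ltnW kN) (leqnn n))) //; lia.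
Qed.

End Thresholds.

Definition linear (f : nat -> nat) : Prop := exists C, forall n, f n <= C * n.+1.

Lemma linear_const k : linear (fun=> k).
Proof. by exists k => n; rewrite leq_pmulr. Qed.

Lemma linear_id : linear (fun n => n).
Proof. by exists 1 => n; rewrite mul1n leqW. Qed.

Lemma linear_add f g : linear f -> linear g -> linear (fun n => f n + g n).
Proof.
by move=> [C fC] [D gD]; exists (C + D) => n; rewrite mulnDl leq_add.
Qed.

Lemma linear_mul k f : linear f -> linear (fun n => k * f n).
Proof. by move=> [C fC]; exists (k * C) => n; rewrite -mulnA leq_mul. Qed.

Lemma linear_mulr k f : linear f -> linear (fun n => f n * k).
Proof. by move=> [C fC]; exists (C * k) => n; rewrite mulnAC leq_mul. Qed.

Lemma linear_succ f : linear f -> linear (fun n => (f n).+1).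
Proof.
move=> lf; have [C fC] := linear_add (linear_const 1) lf.
by exists C => n; apply: fC.
Qed.

Lemma linear_algorithm_time a b d T P : linear (algorithm_time a b d T P).
Proof.
by do ![exact: linear_const | exact: linear_id | apply: linear_add
  | apply: linear_mul | apply: linear_mulr | apply: linear_succ].
Qed.

(** A finite type of presentations of all graphs of order at most [N]: any set of
    pairs is turned into a simple graph by symmetrising and removing loops. *)
Definition code (N : nat) : finType :=
  {n : 'I_N.+1 & {set 'I_n * 'I_n}}.

Definition decode_adj n (E : {set 'I_n * 'I_n}) : rel 'I_n :=
  fun i j => (i != j) && (((i, j) \in E) || ((j, i) \in E)).

Lemma decode_sym n (E : {set 'I_n * 'I_n}) : symmetric (decode_adj E).
Proof. by move=> i j; rewrite /decode_adj eq_sym orbC. Qed.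

Lemma decode_irrefl n (E : {set 'I_n * 'I_n}) : irreflexive (decode_adj E).
Proof. by move=> i; rewrite /decode_adj eqxx. Qed.

Definition decode N (z : code N) : sgraph :=
  SGraph (decode_sym (tagged z)) (decode_irrefl (tagged z)).

Lemma finitely_many_bounded (P : sgraph -> Prop) (N : nat) :
  (forall G, P G -> #|G| <= N) -> finitely_many_up_to_iso P.
Proof.
move=> PN; exists #|code N|, (fun i => decode (enum_val i)) => G /PN GN.
pose E := [set p : 'I_#|G| * 'I_#|G| | adj (enum_val p.1) (enum_val p.2)].
pose n : 'I_N.+1 := Ordinal (GN : #|G| < N.+1).
pose z : code N := Tagged (fun n : 'I_N.+1 => {set 'I_n * 'I_n}) (E : {set 'I_n * _}).
exists (enum_rank z); rewrite enum_rankK.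
exists (enum_rank : G -> 'I_#|G|); first exact: enum_rank_bij.
move=> x y; rewrite /= /decode_adj !inE /= !enum_rankK [adj y x]adj_sym orbb.
by rewrite (inj_eq enum_rank_inj); case: eqVneq => // ->; rewrite adj_irrefl.
Qed.

(** A seed succeeds with probability at least [1 / P], for every labelling that the
    algorithm may compute. *)
Definition seeds_suffice (G : sgraph) (e : bool) (a b d T P : nat) : Prop :=
  forall lab : G -> nat, labelling d lab ->
  exists A : {set {ffun G -> bool}}, 2 ^ #|G| <= P * #|A| /\
    forall s, s \in A -> exists2 j, j <= T &
      rebalances_well e a b (sweep e lab (rounds j (labels d)) s).

Definition good (R : realType) (eps : R) (e : bool) (G : sgraph) (c : G -> bool) : Prop :=
  bisection c /\ ((bad e c)%:R <= eps * #|G|%:R)%R.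

Lemma bisection_imbalance (G : sgraph) (c : G -> bool) : bisection c -> imbalance c <= 1.
Proof.
by rewrite /bisection /imbalance /red /=; move: #|_| #|_| => r b; lia.
Qed.

Lemma seeds_suffice_threshold (R : realType) (d : nat) (eps : R) : (0 < eps)%R ->
  exists a b T P N, [/\ 0 < b, (a%:R <= eps * b%:R)%R &
    forall e (G : sgraph), max_degree G <= d ->
      N <= #|G| \/ (exists c : G -> bool, good eps e c) ->
      seeds_suffice G e a b d T P].
Proof.
move=> eps0; have [q thr] := rational_threshold eps0.
pose T := 8 * (q.+1 * (d.+1 * d.+1)); pose L := d.+1 ^ (T * d.+1).
pose N := (16 * (q.+1 * d.+1 * (q.+1 * d.+1) * (L * L))).+1.
have [a [b [/andP[b0 ba] ab small]]] := thr N.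
(* [2 ^ N] serves both cases: half of all seeds, or one seed in fewer than [2 ^ N] *)
exists a, b, T, (2 ^ N), N; split=> // e G Gd large_or_good lab [plab labs].
case: (leqP N #|G|) => [large|lt].
  have := half_of_seeds_rebalance_well e Gd plab (q := q) labs.
  rewrite size_iota => /(_ large) [j [A [jT A2 A_ok]]]; exists A; split.
    apply: leq_trans A2 _; rewrite leq_mul2r; apply/orP; right.
    by rewrite -[X in X <= _]expn1 leq_exp2l.
  move=> s /A_ok s_ok; exists j => // c' /s_ok.
  by rewrite mul1n => ?; nia.
case: large_or_good => [|[c [bis_c bad_c]]]; first by rewrite leqNgt lt.
exists [set finfun c]; split; first by rewrite cards1 muln1 leq_exp2l // ltnW.
have finfun_c : (finfun c : G -> bool) = c by apply/funext => x; rewrite ffunE.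
move=> s /set1P ->; exists 0 => // c'; rewrite /sweep /= finfun_c => cc'.
have /eqP : #|differ c c'| == 0.
  by have := bisection_imbalance bis_c; lia.
move=> /eqP; rewrite cards_eq0 => /eqP differ0.
have <- : c = c'.
  apply/funext => x; apply/eqP/negPn/negP => xcc'.
  by have := in_set0 x; rewrite -differ0 inE xcc'.
exact: small.
Qed.

Lemma canonical_presentation (G : sgraph) :
  presentation (enum G) (fun x : G => enum (nbrs x)).
Proof. by []. Qed.

Lemma acceptable_good (R : realType) (eps : R) (G : sgraph) e a b (c : G -> bool) :
  0 < b -> (a%:R <= eps * b%:R)%R -> acceptable e a b c -> good eps e c.
Proof.
move=> b0 ab [bis_c bad_c]; split=> //.
have b0' : (0 < b%:R :> R)%R by rewrite ltr0n.
rewrite -(ler_pM2l b0'); apply: (@le_trans _ _ (a%:R * #|G|%:R)%R).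
  by rewrite -!natrM ler_nat.
by rewrite mulrCA mulrA ler_wpM2r ?ler0n.
Qed.

(** The runs of the machine on one presentation of the graph produce the
    labelling and the balanced recolouring. *)
Lemma seeds_suffice_acceptable (G : sgraph) e a b d T P :
  max_degree G <= d -> seeds_suffice G e a b d T P ->
  exists c : G -> bool, acceptable e a b c.
Proof.
move=> Gd seeds; have pres := canonical_presentation G.
set vs := enum G in pres; set nb := (fun x : G => _) in pres.
pose m0 := input_memory vs nb; have m0i : input vs nb m0 by apply: input_input_memory.
have [_ [m1 [_ _ [m1i _ [lab _ lab_ok]]]]] : runs _ _ _ _ :=
  runs_label_all pres Gd m0i (fun=> erefl) erefl.
have [A [PA A_ok]] := seeds lab lab_ok.
have /card_gt0P[s sA] : 0 < #|A|.
  by rewrite lt0n; apply: contraTneq PA => ->; rewrite muln0 -ltnNge expn_gt0.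
have [j _ rebal] := A_ok s sA; set c := sweep _ _ _ _ in rebal.
pose m2 := Memory (reg m1) (upd (arr m1) 4 (nth 0 [seq (c x : nat) | x <- vs])).
have m2i : input vs nb m2 by case: m1i.
have m24 : coded vs m2 4 c.
  by move=> x; rewrite /= /upd /= (nth_map x) ?nth_index ?(ix_lt pres) ?(mem_vs pres).
have [_ [m3 [_ _ [m3_r m3_b fm3]]]] : runs _ _ _ _ := runs_tally pres Gd m2i m24.
have m3i : input vs nb m3 by apply: input_frame fm3 m2i.
have m34 : coded vs m3 4 c by move=> x; rewrite fm3.2.
have [_ [m4 [_ _ [[h [_ bis_h dh]] _]]]] : runs _ _ _ _ :=
  runs_balance pres Gd m3i m34 m3_r m3_b.
by exists h; split=> //; apply: rebal.
Qed.

Lemma finitely_many_without_good (R : realType) (d : nat) (eps : R) e : (0 < eps)%R ->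
  finitely_many_up_to_iso (fun G : sgraph =>
    max_degree G <= d /\ ~ exists c : G -> bool, good eps e c).
Proof.
move=> eps0; have [a [b [T [P [N [b0 ab seeds]]]]]] := seeds_suffice_threshold d eps0.
apply: (@finitely_many_bounded _ N) => G [Gd no_good].
rewrite leqNgt; apply/negP => /ltnW NG; apply: no_good.
have [|c c_ok] := seeds_suffice_acceptable Gd (seeds e G Gd _); first by left.
by exists c; apply: acceptable_good c_ok.
Qed.

Lemma good_findable (R : realType) (d : nat) (eps : R) e : (0 < eps)%R ->
  linear_time_findable R (fun G : sgraph => max_degree G <= d)
    (fun (G : sgraph) (c : G -> bool) => good eps e c).
Proof.
move=> eps0; have [a [b [T [P [N [b0 ab seeds]]]]]] := seeds_suffice_threshold d eps0.
have [C time] := linear_algorithm_time a b d T P.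
exists (algorithm e a b d T), C => G Gd G_good vs nb pres s.
have run_ok t := algorithm_within pres Gd R t (seeds e G Gd (or_intror G_good)).
split=> [w w_halts|].
  have [_ /(_ w (leqnn _) w_halts)] := run_ok (size w).
  exact: acceptable_good.
apply: ge_ereal_sup => _ [t _ <-].
rewrite lee_fin truncated_expected_runtimeE; apply: le_trans (run_ok t).1 _.
by rewrite ler_nat (size_vs pres).
Qed.

Theorem theorem1p4 (R : realType) (d : nat) (eps : R) (heps : (0 < eps)%R) :
  [/\ finitely_many_up_to_iso (fun G : sgraph =>
        max_degree G <= d /\
        ~ exists c : G -> bool, almost_internal_bisection eps c),
      finitely_many_up_to_iso (fun G : sgraph =>
        max_degree G <= d /\
        ~ exists c : G -> bool, almost_external_bisection eps c),
      linear_time_findable R (fun G : sgraph => max_degree G <= d)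
        (fun (G : sgraph) (c : G -> bool) => almost_internal_bisection eps c)
    & linear_time_findable R (fun G : sgraph => max_degree G <= d)
        (fun (G : sgraph) (c : G -> bool) => almost_external_bisection eps c)].
Proof.
split.
- exact: (@finitely_many_without_good R d eps false).
- exact: (@finitely_many_without_good R d eps true).
- exact: (@good_findable R d eps false).
- exact: (@good_findable R d eps true).
Qed.
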